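(* Let $q>0$, $q\ne1$, $M\ge1$, $\vec N=(N_1,\dots,N_M)\in(\mathbb{Z}_{\ge0})^M$, $\vec x,\vec y\in\prod_{i=1}^M\{0,\dots,N_i\}$, and let $s,t,v\in\mathbb{C}$ be such that no denominator in the coefficients vanishes (automatic if $t\in\mathbb{R}$). Then for every $j=1,\dots,M$, $R_{\mathrm r}(\vec x,\vec y)=R_{\mathrm r}(\vec x,\vec y;s,t,v,\vec N;q)$ satisfies $$[h_M(\vec x,s)]_q\sum_{\vec\varepsilon\in\mathcal{E}_j}A^{(j)}_{\vec\varepsilon}(\vec y,t)R_{\mathrm r}(\vec x,\vec y+\vec\varepsilon)=[h_{M-j}(\vec x,s)]_qR_{\mathrm r}(\vec x,\vec y)+\sum_{\vec\varepsilon\in\mathcal{E}_j}B^{(j)}_{\vec\varepsilon}(\vec y,t)R_{\mathrm r}(\vec x,\vec y+\vec\varepsilon),$$ where terms with $\vec y+\vec\varepsilon\notin\prod_i\{0,\dots,N_i\}$ are omitted (their coefficients are zero).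
   Context: $q^z=e^{z\log q}$; $[z]_q=\frac{q^z-q^{-z}}{q-q^{-1}}$, $\{z\}_q=\frac{q^z+q^{-z}}{q+q^{-1}}$; $(\alpha;p)_n=\prod_{i=0}^{n-1}(1-\alpha p^i)$, $(\alpha_1,\dots,\alpha_m;p)_n=\prod_i(\alpha_i;p)_n$; $\begin{bmatrix}N\\ n\end{bmatrix}_{p}=\frac{(p;p)_N}{(p;p)_n(p;p)_{N-n}}$. For $N\in\mathbb{Z}_{\ge0}$, $u,s\in\mathbb{C}$, $n,x\in\{0,\dots,N\}$, $$k_{u,s}(n,x;N)=(-1)^nq^{n(s-u-\frac12N+\frac12)}\sum_{l=0}^{\min(n,x)}\frac{(q^{2n},\,q^{2x},\,-q^{-2x-2s+2N};q^{-2})_l}{(q^{2N},\,q^{-2};q^{-2})_l}q^{-2l},\qquad w(n;N)=q^{n(n-N)}\begin{bmatrix}N\\ n\end{bmatrix}_{q^2}.$$ Height function: $h_i(\vec y,t)=t+\sum_{l=1}^i(2y_l-N_l)$, $h_0(\vec y,t)=t$. Then $$K_{v,t}(\vec n,\vec y)=\prod_{i=1}^M k_{v,h_{i-1}(\vec y,t)}(n_i,y_i;N_i),\qquad R_{\mathrm r}(\vec x,\vec y;s,t,v,\vec N;q)=\sum_{n_1=0}^{N_1}\cdots\sum_{n_M=0}^{N_M}K_{1,s}(\vec n,\vec x)K_{v,t}(\vec n,\vec y)\prod_{i=1}^Mw(n_i;N_i).$$ Index set: $\mathcal{E}_j$ is the set of $\vec\varepsilon\in\{0,\pm1,\pm2\}^M$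 with $\varepsilon_i=0$ for $i=1,\dots,M-j$ and $\sum_{i=1}^\ell\varepsilon_i\in\{-1,0,1\}$ for $\ell=1,\dots,M$. Univariate coefficients $a_{\varepsilon,m}(y,t;N)$ with $m\in\{0,2,-2\}$: $$a_{-1,0}=-\frac{q^{-4y-2t+3N+2}(1-q^{-2y})(1+q^{-2y-2t})}{(1+q^{-4y-2t+2N+2})(1+q^{-4y-2t+2N})},\quad a_{1,0}=\frac{q^{-N}(1-q^{-2y+2N})(1+q^{-2y-2t+2N})}{(1+q^{-4y-2t+2N})(1+q^{-4y-2t+2N-2})},\quad a_{0,0}=q^{-N}-a_{-1,0}-a_{1,0},$$ $$a_{-2,2}=\frac{q^{-N}(1-q^{2y})(1-q^{2y-2})}{(1+q^{4y+2t-2N})(1+q^{4y+2t-2N-2})},\quad a_{-1,2}=\frac{q^{-N}(1+q^2)(1-q^{2y})(1+q^{2N-2y-2t})}{(1+q^{4y+2t-2N+2})(1+q^{2N-4y-2t+2})},\quad a_{0,2}=\frac{q^{-N}(1+q^{2N-2y-2t})(1+q^{2N-2y-2t-2})}{(1+q^{2N-4y-2t})(1+q^{2N-4y-2t-2})},$$ $$a_{0,-2}=\frac{q^{-N}(1+q^{2y+2t})(1+q^{2y+2t-2})}{(1+q^{4y+2t-2N})(1+q^{4y+2t-2N-2})},\quad a_{1,-2}=\frac{q^{-N}(1+q^2)(1-q^{2N-2y})(1+q^{2y+2t})}{(1+q^{2N-4y-2t+2})(1+q^{4y+2t-2N+2})},\quad a_{2,-2}=\frac{q^{-N}(1-q^{2N-2y})(1-q^{2N-2y-2})}{(1+q^{2N-4y-2t})(1+q^{2N-4y-2t-2})}.$$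 Multivariate coefficients: $$A^{(j)}_{\vec\varepsilon}(\vec y,t)=\prod_{i=M-j+1}^M a_{\varepsilon_i,m_i}\big(y_i,h_{i-1}(\vec y,t);N_i\big),\qquad m_i=2\sum_{l=1}^{i-1}\varepsilon_l,$$ and, with $\sigma=\sum_{i=1}^M\varepsilon_i$, $B^{(j)}_{\vec\varepsilon}(\vec y,t)$ equals - $A^{(j)}_{\vec\varepsilon}(\vec y,t)[h_M(\vec y,t)+v-1]_q$ if $\sigma=-1$; - $A^{(j)}_{\vec\varepsilon}(\vec y,t)[h_M(\vec y,t)]_q\{v\}_q-[h_{M-j}(\vec y,t)]_q\{v\}_q$ if $\vec\varepsilon=0$; - $A^{(j)}_{\vec\varepsilon}(\vec y,t)[h_M(\vec y,t)]_q\{v\}_q$ if $\sigma=0$, $\vec\varepsilon\ne0$; - $A^{(j)}_{\vec\varepsilon}(\vec y,t)[h_M(\vec y,t)-v+1]_q$ if $\sigma=1$. *)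

(* Defs.v *)
From HB Require Import structures.
From mathcomp Require Import all_boot all_order all_algebra.
From mathcomp Require Import reals sequences exp trigo.
From mathcomp Require Export complex.

Set Implicit Arguments.
Unset Strict Implicit.
Unset Printing Implicit Defensive.

Import Order.TTheory GRing.Theory Num.Theory.

Local Open Scope ring_scope.
Local Open Scope complex_scope.

Definition cexp (R : realType) (z : R[i]) : R[i] :=
  let: a +i* b := z in (expR a * cos b) +i* (expR a * sin b).

(* q ^ z = exp (z log q), for real q > 0 and complex z *)
Definition qpow (R : realType) (q : R) (z : R[i]) : R[i] :=
  cexp (z * (ln q)%:C).

(* [z]_q *)
Definition qbrack (R : realType) (q : R) (z : R[i]) : R[i] :=
  (qpow q z - qpow q (- z)) / (qpow q 1 - qpow q (- 1)).

(* {z}_q *)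
Definition qbrace (R : realType) (q : R) (z : R[i]) : R[i] :=
  (qpow q z + qpow q (- z)) / (qpow q 1 + qpow q (- 1)).

(* (a; p)_n *)
Definition qpoch (F : fieldType) (a p : F) (n : nat) : F :=
  \prod_(i < n) (1 - a * p ^+ i).

(* (a_1, ..., a_m; p)_n *)
Definition qpochs (F : fieldType) (s : seq F) (p : F) (n : nat) : F :=
  \prod_(a <- s) qpoch a p n.

(* Gaussian binomial [N over n]_p, used for n <= N only *)
Definition qbinom (F : fieldType) (p : F) (N n : nat) : F :=
  qpoch p p N / (qpoch p p n * qpoch p p (N - n)).

(* k_{u,s}(n, x; N) *)
Definition kpoly (R : realType) (q : R) (u s : R[i]) (n x N : nat) : R[i] :=
  let Q := qpow q in
  (-1) ^+ n * Q (n%:R * (s - u - N%:R / 2 + 1 / 2)) *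
  \sum_(l < (minn n x).+1)
    qpochs [:: Q (2 * n%:R); Q (2 * x%:R); - Q (- 2 * x%:R - 2 * s + 2 * N%:R)]
      (Q (- 2)) l
    / qpochs [:: Q (2 * N%:R); Q (- 2)] (Q (- 2)) l
    * Q (- 2 * l%:R).

(* w(n; N) *)
Definition weight (R : realType) (q : R) (n N : nat) : R[i] :=
  qpow q (n%:R * (n%:R - N%:R)) * qbinom (qpow q 2) N n.

(* Vectors indexed by 1, ..., M are functions on 'I_M: the i-th coordinate is
   stored at the ordinal of value i - 1.  The height h_i keeps its index
   i = 0, ..., M, so h_{i-1} at the i-th coordinate is [height N y t k] with
   k : 'I_M of value i - 1. *)
Definition height (R : realType) (M : nat) (N y : 'I_M -> nat) (t : R[i])
    (i : nat) : R[i] :=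
  t + \sum_(l < M | (l < i)%N) (2 * (y l)%:R - (N l)%:R).

(* K_{v,t}(n, y) *)
Definition Kpoly (R : realType) (q : R) (M : nat) (N : 'I_M -> nat)
    (v t : R[i]) (n y : 'I_M -> nat) : R[i] :=
  \prod_(i < M) kpoly q v (height N y t i) (n i) (y i) (N i).

(* R_r(x, y; s, t, v, N; q) *)
Definition Rr (R : realType) (q : R) (M : nat) (N : 'I_M -> nat)
    (s t v : R[i]) (x y : 'I_M -> nat) : R[i] :=
  \sum_(n : {dffun forall i : 'I_M, 'I_(N i).+1})
    Kpoly q N 1 s (fun i => n i : nat) x * Kpoly q N v t (fun i => n i : nat) y
    * \prod_(i < M) weight q (n i) (N i).

(* the integers 0, +-1, +-2, as a finite type *)
Definition step : finType := seq_sub [:: - 2; - 1; 0; 1; 2 : int].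

Definition stepz (M : nat) (e : {ffun 'I_M -> step}) (i : 'I_M) : int :=
  ssval (e i).

(* e_1 + ... + e_k *)
Definition psum (M : nat) (e : {ffun 'I_M -> step}) (k : nat) : int :=
  \sum_(l < M | (l < k)%N) stepz e l.

(* the index set E_j; k : 'I_M stands for the position k + 1, so
   "i = 1, ..., M - j" reads k < M - j *)
Definition Eset (M j : nat) : {set {ffun 'I_M -> step}} :=
  [set e | [forall k : 'I_M, (k < M - j)%N ==> (stepz e k == 0)]
           && [forall k : 'I_M, psum e k.+1 \in [:: - 1; 0; 1 : int]]].

(* (numerator, denominator) of the coefficient a_{e,m}(y, t; N) in the eight
   cases (e, m) <> (0, 0) where it is given by a fraction; dummy otherwise *)
Definition coef_frac (R : realType) (q : R) (e m : int) (y : nat) (t : R[i])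
    (N : nat) : R[i] * R[i] :=
  let Q := qpow q in let y := y%:R in let N := N%:R in
  match m, e with
  | 0%Z, (-1)%Z =>
    (- Q (- 4 * y - 2 * t + 3 * N + 2)
       * (1 - Q (- 2 * y)) * (1 + Q (- 2 * y - 2 * t)),
     (1 + Q (- 4 * y - 2 * t + 2 * N + 2)) * (1 + Q (- 4 * y - 2 * t + 2 * N)))
  | 0%Z, 1%Z =>
    (Q (- N) * (1 - Q (- 2 * y + 2 * N)) * (1 + Q (- 2 * y - 2 * t + 2 * N)),
     (1 + Q (- 4 * y - 2 * t + 2 * N)) * (1 + Q (- 4 * y - 2 * t + 2 * N - 2)))
  | 2%Z, (-2)%Z =>
    (Q (- N) * (1 - Q (2 * y)) * (1 - Q (2 * y - 2)),
     (1 + Q (4 * y + 2 * t - 2 * N)) * (1 + Q (4 * y + 2 * t - 2 * N - 2)))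
  | 2%Z, (-1)%Z =>
    (Q (- N) * (1 + Q 2) * (1 - Q (2 * y)) * (1 + Q (2 * N - 2 * y - 2 * t)),
     (1 + Q (4 * y + 2 * t - 2 * N + 2)) * (1 + Q (2 * N - 4 * y - 2 * t + 2)))
  | 2%Z, 0%Z =>
    (Q (- N) * (1 + Q (2 * N - 2 * y - 2 * t))
       * (1 + Q (2 * N - 2 * y - 2 * t - 2)),
     (1 + Q (2 * N - 4 * y - 2 * t)) * (1 + Q (2 * N - 4 * y - 2 * t - 2)))
  | (-2)%Z, 0%Z =>
    (Q (- N) * (1 + Q (2 * y + 2 * t)) * (1 + Q (2 * y + 2 * t - 2)),
     (1 + Q (4 * y + 2 * t - 2 * N)) * (1 + Q (4 * y + 2 * t - 2 * N - 2)))
  | (-2)%Z, 1%Z =>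
    (Q (- N) * (1 + Q 2) * (1 - Q (2 * N - 2 * y)) * (1 + Q (2 * y + 2 * t)),
     (1 + Q (2 * N - 4 * y - 2 * t + 2)) * (1 + Q (4 * y + 2 * t - 2 * N + 2)))
  | (-2)%Z, 2%Z =>
    (Q (- N) * (1 - Q (2 * N - 2 * y)) * (1 - Q (2 * N - 2 * y - 2)),
     (1 + Q (2 * N - 4 * y - 2 * t)) * (1 + Q (2 * N - 4 * y - 2 * t - 2)))
  | _, _ => (0, 1)
  end.

Definition coef_quot (R : realType) (q : R) (e m : int) (y : nat) (t : R[i])
    (N : nat) : R[i] :=
  (coef_frac q e m y t N).1 / (coef_frac q e m y t N).2.

(* a_{e,m}(y, t; N) *)
Definition acoef (R : realType) (q : R) (e m : int) (y : nat) (t : R[i])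
    (N : nat) : R[i] :=
  if (e == 0) && (m == 0)
  then qpow q (- N%:R) - coef_quot q (- 1) 0 y t N - coef_quot q 1 0 y t N
  else coef_quot q e m y t N.

(* no denominator vanishes in the coefficients a_{e,m}(y_i, h_{i-1}(y,t); N_i) *)
Definition denominators_neq0 (R : realType) (q : R) (M : nat)
    (N y : 'I_M -> nat) (t : R[i]) : Prop :=
  forall (i : 'I_M) (e m : int),
    (coef_frac q e m (y i) (height N y t i) (N i)).2 != 0.

(* A^{(j)}_e(y, t), with m_i = 2 (e_1 + ... + e_{i-1}) *)
Definition Acoef (R : realType) (q : R) (M : nat) (N : 'I_M -> nat) (j : nat)
    (e : {ffun 'I_M -> step}) (y : 'I_M -> nat) (t : R[i]) : R[i] :=
  \prod_(i < M | (M - j <= i)%N)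
    acoef q (stepz e i) (2 * psum e i) (y i) (height N y t i) (N i).

(* B^{(j)}_e(y, t); the last branch is the case e_1 + ... + e_M = 0, e <> 0,
   as e_1 + ... + e_M is -1, 0 or 1 on E_j *)
Definition Bcoef (R : realType) (q : R) (M : nat) (N : 'I_M -> nat) (v : R[i])
    (j : nat) (e : {ffun 'I_M -> step}) (y : 'I_M -> nat) (t : R[i]) : R[i] :=
  let A := Acoef q N j e y t in
  let h := height N y t in
  if psum e M == - 1 then A * qbrack q (h M + v - 1)
  else if psum e M == 1 then A * qbrack q (h M - v + 1)
  else if [forall i, stepz e i == 0]
  then A * qbrack q (h M) * qbrace q v - qbrack q (h (M - j)%N) * qbrace q v
  else A * qbrack q (h M) * qbrace q v.

Definition in_box (M : nat) (N y : 'I_M -> nat) (e : {ffun 'I_M -> step})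
    : bool :=
  [forall i, 0 <= (y i)%:Z + stepz e i <= (N i)%:Z].

(* y + e, as a vector of naturals; meaningful only when [in_box N y e] *)
Definition shift (M : nat) (y : 'I_M -> nat) (e : {ffun 'I_M -> step})
    : 'I_M -> nat :=
  fun i => absz ((y i)%:Z + stepz e i).

(* Main.v *)
(* For one leg (M = 1), k_{1,s}(n,x) and k_{v,t}(n,y) are bispectral.  In y they
   satisfy
     sum_e a_{e,m}(y,t) k_{v,t+m}(n,y+e) = q^(2n-N) k_{v,t}(n,y),  m = 0, 2, -2,
   and in n they satisfy a three-term recurrence
     [t+2y-N] k_{v,t}(n) = [t] q^(N-2n) k_{v,t}(n) + (X_v k_{v,t})(n),
   where X_v is off-diagonal, does not depend on t, and q^(2n-N) X_1 is symmetric
   for the weight w.  Moreover q^(2n-N) X_1 is a linear combination of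
   q^(2n-N) X_v and X_v q^(2n-N); moving X_1 from k_{1,s} to k_{v,t} in the sum
   over n therefore gives, with rho the one-leg sum and beta the same sum with the
   extra weight q^(2n-N),
     sum_e a_{e,m}(y,t) (c [t+2y-N] + c' [t+m+2(y+e)-N]) rho(t+m, y+e)
       = (c [t] + c' [t+m]) rho + [s+2x-N] beta - [s] rho,   c + c' = {v}.
   R_r is the product over the legs of such sums, with t and s replaced by the
   heights h_{i-1}.  As t + 2y - N is the height after the leg, the right-hand
   sides telescope when the legs M-j+1, ..., M are summed one after the other. *)
Require Import Defs.
From mathcomp Require Import all_boot all_order all_algebra.
From mathcomp Require Import boolp reals sequences exp trigo.
From mathcomp Require Import ring zify.

Import Order.TTheory GRing.Theory Num.Theory.
Local Open Scope ring_scope.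

Set Implicit Arguments.
Unset Strict Implicit.
Unset Printing Implicit Defensive.

(** * The basic hypergeometric sum *)

Section BasicHypergeometric.
Variables (F : fieldType) (p : F).

Lemma qpochSr (a : F) n : qpoch a p n.+1 = qpoch a p n * (1 - a * p ^+ n).
Proof. by rewrite /qpoch big_ord_recr. Qed.

Lemma qpochSl (a : F) n : qpoch a p n.+1 = (1 - a) * qpoch (a * p) p n.
Proof.
rewrite /qpoch big_ord_recl expr0 mulr1; congr (_ * _).
by apply: eq_bigr => i _; rewrite exprS mulrA.
Qed.

Lemma qpoch0 (a : F) : qpoch a p 0 = 1.
Proof. by rewrite /qpoch big_ord0. Qed.

Lemma qpoch_eq0 (a : F) n m : (n < m)%N -> a * p ^+ n = 1 -> qpoch a p m = 0.
Proof.
move=> ltnm apn; rewrite /qpoch (bigD1 (Ordinal ltnm)) //= apn subrr.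
by rewrite mul0r.
Qed.

Hypothesis p_neq0 : p != 0.
Hypothesis p_nroot : forall k, (0 < k)%N -> p ^+ k != 1.
Variable N : nat.
Local Notation P := (p ^+ N).

(* With Y = q^(2y), W = - q^(2N-2y-2t), p = q^(-2) and z = p^(-n), [phi z Y W]
   is the sum in k_{v,t}(n,y;N).  It is symmetric in Y and W; the shift of y by 1
   divides Y by p and multiplies W by p, the shift of t by 1 multiplies W by p. *)
Definition phi_coef (z : F) l :=
  qpoch z p l / (qpoch P^-1 p l * qpoch p p l) * p ^+ l.

Definition phi (z Y W : F) :=
  \sum_(l < N.+1) phi_coef z l * (qpoch Y p l * qpoch W p l).

Lemma qpoch_pN_factor_neq0 l : (l < N)%N -> 1 - P^-1 * p ^+ l != 0.
Proof.
move=> ltlN; rewrite subr_eq0 eq_sym; apply/eqP => /(congr1 ( *%R P)).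
rewrite mulrA divff ?expf_neq0 // mul1r mulr1 -(subnK (ltnW ltlN)) exprD.
move/eqP; rewrite -subr_eq0 -{1}[p ^+ l]mul1r -mulrBl mulf_eq0.
rewrite (negPf (expf_neq0 _ p_neq0)) orbF subr_eq0 eq_sym.
by rewrite (negPf (p_nroot _)) // subn_gt0.
Qed.

Lemma one_sub_expr_neq0 l : 1 - p ^+ l.+1 != 0.
Proof. by rewrite subr_eq0 eq_sym p_nroot. Qed.

Lemma qpoch_pN_neq0 l : (l <= N)%N -> qpoch P^-1 p l != 0.
Proof.
move=> lelN; apply/prodf_neq0 => i _; apply: qpoch_pN_factor_neq0.
exact: leq_trans (ltn_ord i) lelN.
Qed.

Lemma qpoch_p_neq0 l : qpoch p p l != 0.
Proof.
by apply/prodf_neq0 => i _; rewrite -exprS; apply: one_sub_expr_neq0.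
Qed.

(* The two-term relations [phi_raise] and [phi_lower] change t by +1 and -1; all
   the coefficients a_{e,m} are compositions of two of them. *)
Lemma phi_raise z Y W : Y != 0 -> W != 0 -> Y != W ->
  phi z Y W = (1 - Y) / (1 - Y / W) * phi z (Y * p) W
            + (1 - W) / (1 - W / Y) * phi z Y (W * p).
Proof.
move=> Y0 W0 YW; rewrite /phi !mulr_sumr -big_split /=.
apply: eq_bigr => l _.
set f := phi_coef z l.
(* By [EY] and [EW] the identity holds term by term: it reduces to (1 - Y p^l)/(1 - Y/W) + (1 - W
   p^l)/(1 - W/Y) = 1. *)
have EY : (1 - Y) * qpoch (Y * p) p l = qpoch Y p l * (1 - Y * p ^+ l).
  by rewrite -qpochSl qpochSr.
have EW : (1 - W) * qpoch (W * p) p l = qpoch W p l * (1 - W * p ^+ l).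
  by rewrite -qpochSl qpochSr.
transitivity (f * (((1 - Y) * qpoch (Y * p) p l) * qpoch W p l) / (1 - Y / W)
  + f * (qpoch Y p l * ((1 - W) * qpoch (W * p) p l)) / (1 - W / Y)); last by ring.
rewrite EY EW; field.
have H1 : Y - W != 0 by rewrite subr_eq0.
have H2 : W - Y != 0 by rewrite subr_eq0 eq_sym.
by rewrite Y0 W0 H1 H2.
Qed.

Lemma phi_lower n Y W : (n <= N)%N -> Y != 0 -> W != 0 -> Y != W ->
  p ^- n * phi (p ^- n) Y W =
    (1 - (P * W)^-1) / (1 - Y / W) * phi (p ^- n) Y (W / p)
  + (1 - (P * Y)^-1) / (1 - W / Y) * phi (p ^- n) (Y / p) W.
Proof.
move=> lenN Y0 W0 YW; set z := p ^- n.
have H1 : Y - W != 0 by rewrite subr_eq0.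
have H2 : W - Y != 0 by rewrite subr_eq0 eq_sym.
have P0 : P != 0 by rewrite expf_neq0.
(* The partial sums telescope; the boundary term vanishes as (p^(-n); p)_(N+1) = 0. *)
pose S K := \sum_(l < K.+1) phi_coef z l *
   (z * (qpoch Y p l * qpoch W p l)
   - ((1 - (P * W)^-1) / (1 - Y / W) * (qpoch Y p l * qpoch (W / p) p l)
   + (1 - (P * Y)^-1) / (1 - W / Y) * (qpoch (Y / p) p l * qpoch W p l))).
suff SE K : (K <= N)%N ->
    S K = (z - p ^- K) * phi_coef z K * (qpoch Y p K * qpoch W p K).
  have SN : S N = 0.
    rewrite SE // /phi_coef !mulrA [_ * qpoch z p N]mulrC.
    suff -> : qpoch z p N * (z - p ^- N) = 0 by rewrite !mul0r.
    have : qpoch z p N.+1 = 0.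
      by rewrite (@qpoch_eq0 _ n) ?ltnS // mulVf // expf_neq0.
    rewrite qpochSr => /(congr1 ( *%R^~ (- p ^- N))); rewrite mul0r => <-.
    by field.
  apply/eqP; rewrite -subr_eq0 -SN /S /phi !mulr_sumr -big_split -sumrB /=.
  by apply/eqP/eq_bigr => l _; ring.
elim: K => [_|K IH ltKN]; rewrite /S.
  rewrite big_ord1 /= /phi_coef !qpoch0; field.
  by rewrite Y0 W0 H1 H2 P0 oner_neq0.
rewrite big_ord_recr -/(S K) (IH (ltnW ltKN)) /=.
have HY : qpoch (Y / p) p K.+1 = (1 - Y / p) * qpoch Y p K.
  by rewrite qpochSl divfK.
have HW : qpoch (W / p) p K.+1 = (1 - W / p) * qpoch W p K.
  by rewrite qpochSl divfK.
rewrite HY HW /phi_coef !qpochSr.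
have := qpoch_pN_neq0 (ltnW ltKN); have := qpoch_p_neq0 K.
have := qpoch_pN_factor_neq0 ltKN; have := one_sub_expr_neq0 K.
rewrite !exprS; set L := p ^+ K; set D1 := qpoch P^-1 p K.
set D2 := qpoch p p K; set ZK := qpoch z p K.
have L0 : L != 0 by rewrite expf_neq0.
move: L0; move: (p ^+ N) P0 => P P0 L0 f1 f2 d2 d1.
have f3 : P - L != 0 by apply: contraNneq f2 => /subr0_eq ->; rewrite mulVf // subrr.
field.
by rewrite ?Y0 ?W0 ?H1 ?H2 ?P0 ?p_neq0 ?L0 ?d1 ?d2 ?f1 ?f3.
Qed.

(** The source of the recurrence in n: for z = p^(-n), dividing or multiplying z by p changes n by
    +1 or -1. The partial sums telescope again; the boundary term now carries (Y; p)_(N+1), which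
    vanishes for Y = p^(-y) with y <= N. *)
Lemma phi_rec z Y W : z != 0 -> qpoch Y p N.+1 = 0 ->
  - (W + Y) * phi z Y W =
    ((P * z)^-1 - 1) * phi (z / p) Y W
    - (W * Y + P^-1) / z * phi z Y W
    - W * Y * (1 - z^-1) * phi (z * p) Y W.
Proof.
move=> z0 YN.
have P0 : P != 0 by rewrite expf_neq0.
pose S K := \sum_(l < K.+1) (- (W + Y) * phi_coef z l
  - (((P * z)^-1 - 1) * phi_coef (z / p) l
    - (W * Y + P^-1) / z * phi_coef z l
    - W * Y * (1 - z^-1) * phi_coef (z * p) l)) * (qpoch Y p l * qpoch W p l).
suff SE K : (K <= N)%N ->
    S K = p ^- K * phi_coef z K * (qpoch Y p K.+1 * qpoch W p K.+1).
  have SN : S N = 0 by rewrite SE // YN mul0r mulr0.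
  apply/eqP; rewrite -subr_eq0 -SN /S /phi !mulr_sumr -!sumrB /=.
  by apply/eqP/eq_bigr => l _; ring.
have zpE l : (1 - z) * qpoch (z * p) p l = qpoch z p l * (1 - z * p ^+ l).
  by rewrite -qpochSl qpochSr.
(* Absorbing 1 - z^-1 into the shifted symbol avoids a division by 1 - z, which is 0 at n = 0. *)
have fE l : W * Y * (1 - z^-1) * phi_coef (z * p) l
    = - (W * Y / z) * phi_coef z l * (1 - z * p ^+ l).
  rewrite /phi_coef.
  transitivity (- (W * Y / z) * ((1 - z) * qpoch (z * p) p l) 
     / (qpoch P^-1 p l * qpoch p p l) * p ^+ l); last by rewrite zpE; ring.
  by rewrite !mulrA; congr (_ * _ * _ * _); field.
elim: K => [_|K IH ltKN]; rewrite /S.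
  rewrite big_ord1 /= fE /phi_coef !qpochSr !qpoch0 !expr0; field.
  by rewrite z0 P0 oner_neq0.
rewrite big_ord_recr -/(S K) (IH (ltnW ltKN)) /= fE.
have Hz : qpoch (z / p) p K.+1 = (1 - z / p) * qpoch z p K.
  by rewrite qpochSl divfK.
rewrite /phi_coef Hz !qpochSr.
have := qpoch_pN_neq0 (ltnW ltKN); have := qpoch_p_neq0 K.
have := qpoch_pN_factor_neq0 ltKN; have := one_sub_expr_neq0 K.
rewrite !exprS; set L := p ^+ K; set D1 := qpoch P^-1 p K.
set D2 := qpoch p p K; set ZK := qpoch z p K.
have L0 : L != 0 by rewrite expf_neq0.
move: L0; move: (p ^+ N) P0 => P P0 L0 f1 f2 d2 d1.
have f3 : P - L != 0 by apply: contraNneq f2 => /subr0_eq ->; rewrite mulVf // subrr.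
field.
by rewrite ?z0 ?P0 ?p_neq0 ?L0 ?d1 ?d2 ?f1 ?f3.
Qed.

End BasicHypergeometric.

(** * Complex powers of q *)

Section ComplexPowers.
Variables (R : realType) (q : R).
Local Notation Q := (qpow q).

Lemma qpowD z z' : Q (z + z') = Q z * Q z'.
Proof.
rewrite /qpow mulrDl; case: (z * _) => a b; case: (z' * _) => c d.
apply/eqP; rewrite eq_complex /= expRD cosD sinD.
by apply/andP; split; apply/eqP; ring.
Qed.

Lemma qpow0 : Q 0 = 1.
Proof. by rewrite /qpow mul0r /cexp /= expR0 cos0 sin0 mulr1 mulr0. Qed.

Lemma qpow_neq0 z : Q z != 0.
Proof.
apply/eqP => Qz0; have := qpow0; rewrite -(subrr z) qpowD Qz0 mul0r => /eqP.
by rewrite eq_sym oner_eq0.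
Qed.

Lemma qpowN z : Q (- z) = (Q z)^-1.
Proof.
by apply: (mulfI (qpow_neq0 z)); rewrite -qpowD subrr qpow0 divff ?qpow_neq0.
Qed.

Lemma qpowMn n z : Q (n%:R * z) = Q z ^+ n.
Proof.
elim: n => [|n IH]; first by rewrite mul0r qpow0.
by rewrite -natr1 mulrDl mul1r qpowD IH exprSr.
Qed.

Hypotheses (q_gt0 : 0 < q) (q_neq1 : q != 1).

(** The hypotheses on q enter through [ln q != 0]. They give p = q^(-2) infinite order, so that the
    denominators of the basic sums do not vanish. *)
Lemma qpow_nat_neq1 k : (0 < k)%N -> Q k%:R != 1.
Proof.
move=> k0; rewrite /qpow -[k%:R](rmorph_nat (real_complex R)) -rmorphM /=.
rewrite cos0 mulr1; apply/negP => /eqP [] /(congr1 (@ln R)).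
rewrite expRK ln1 => /eqP; rewrite mulf_eq0 pnatr_eq0 ln_eq0 //.
by rewrite (negPf q_neq1) -leqn0 leqNgt k0.
Qed.

Lemma qpow_N2_expr_neq1 k : (0 < k)%N -> Q (- 2) ^+ k != 1.
Proof.
move=> k0; rewrite qpowN exprVn invr_eq1 -qpowMn -natrM.
by rewrite qpow_nat_neq1 // muln_gt0 k0.
Qed.

End ComplexPowers.

(** * Univariate functions *)

Section ExtendedK.
Variables (R : realType) (q : R).
Variable N : nat.
Local Notation Q := (qpow q).
Local Notation p := (qpow q (- 2)).
Local Notation P := (p ^+ N).

Let p_neq0 : p != 0 := qpow_neq0 q (- 2).

Definition Yvar (y : R[i]) : R[i] := Q (2 * y).
Definition Wvar (y t : R[i]) : R[i] := - Q (2 * N%:R - 2 * y - 2 * t).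

Lemma Yvar_neq0 y : Yvar y != 0.
Proof. exact: qpow_neq0. Qed.

Lemma Wvar_neq0 y t : Wvar y t != 0.
Proof. by rewrite oppr_eq0 qpow_neq0. Qed.

(* k_{v,t}(n, y; N) for y not necessarily in {0, ..., N}. *)
Definition kext (v t : R[i]) (n : nat) (y : R[i]) : R[i] :=
  (- Q (t - v - N%:R / 2 + 1 / 2)) ^+ n
  * phi p N (p ^- n) (Yvar y) (Wvar y t).

Lemma expr_pN : P = Q (- 2 * N%:R).
Proof. by rewrite -qpowMn mulrC. Qed.

Lemma Yvar_nat n : Yvar n%:R = p ^- n.
Proof. by rewrite /Yvar -qpowMn -qpowN; congr Q; ring. Qed.

(** The sum in [kpoly] stops at min(n, y), that in [phi] at N. The extra terms vanish: for l >
    min(n, y), one of (p^(-n); p)_l and (p^(-y); p)_l contains a zero factor. *)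
Lemma kpolyE v t n y : (n <= N)%N ->
  kpoly q v t n y N = kext v t n y%:R.
Proof.
move=> lenN; rewrite /kpoly /kext qpowMn.
rewrite -exprMn mulN1r; congr (_ * _); rewrite /phi.
have lemN : ((minn n y).+1 <= N.+1)%N by rewrite ltnS geq_min lenN.
rewrite (big_ord_widen N.+1
  (fun l => qpochs _ _ l / qpochs _ _ l * _ (_ * l%:R)) lemN) big_mkcond /=.
apply: eq_bigr => l _; case: ifP => [_|].
  rewrite /qpochs /phi_coef !big_cons !big_nil !mulr1.
  have -> : Q (-2 * l%:R) = p ^+ l by rewrite -qpowMn; congr Q; ring.
  have -> : Q (2 * N%:R) = P^-1 by rewrite expr_pN -qpowN; congr Q; ring.
  rewrite -/(Yvar n%:R) -/(Yvar y%:R) Yvar_nat.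
  have -> : - Q (-2 * y%:R - 2 * t + 2 * N%:R) = Wvar y%:R t.
    by congr (- Q _); ring.
  by rewrite !mulrA; ring.
rewrite ltnS => /negbT; rewrite -ltnNge => lt_l.
rewrite /phi_coef.
have [le_ny|lt_yn] := leqP n y.
  rewrite (@qpoch_eq0 _ _ (p ^- n) n) ?mul0r //.
    by rewrite -[n in (n < _)%N](minn_idPl le_ny).
  by rewrite mulVf // expf_neq0.
rewrite Yvar_nat (@qpoch_eq0 _ _ (p ^- y) y) ?mul0r ?mulr0 //.
  by rewrite -[y in (y < _)%N](minn_idPr (ltnW lt_yn)).
by rewrite mulVf // expf_neq0.
Qed.

End ExtendedK.

(** * Contiguous relations in y and t *)

Section Contiguity.
Variables (R : realType) (q : R).
Hypotheses (q_gt0 : 0 < q) (q_neq1 : q != 1).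
Variable N : nat.
Local Notation Q := (qpow q).
Local Notation p := (qpow q (- 2)).
Local Notation P := (p ^+ N).
Local Notation kext := (kext q N).
Local Notation Yvar := (Yvar q).
Local Notation Wvar := (Wvar q N).

Let p_neq0 : p != 0 := qpow_neq0 q (- 2).
Let p_nroot : forall k, (0 < k)%N -> p ^+ k != 1 :=
  qpow_N2_expr_neq1 q_gt0 q_neq1.

Definition raise_coef (Y W : R[i]) := (1 - Y) / (1 - Y / W).
Definition lower_coef (Y W : R[i]) := (1 - (P * W)^-1) / (1 - Y / W).

Lemma YvarB1 y : Yvar (y - 1) = Yvar y * p.
Proof. by rewrite -qpowD; congr Q; ring. Qed.

Lemma YvarD1 y : Yvar (y + 1) = Yvar y / p.
Proof. by rewrite -qpowN -qpowD; congr Q; ring. Qed.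

Lemma WvarBD y t : Wvar (y - 1) (t + 1) = Wvar y t.
Proof. by congr (- Q _); ring. Qed.

Lemma WvarDB y t : Wvar (y + 1) (t - 1) = Wvar y t.
Proof. by congr (- Q _); ring. Qed.

Lemma WvarD1 t y : Wvar y (t + 1) = Wvar y t * p.
Proof. by rewrite mulNr -qpowD; congr (- Q _); ring. Qed.

Lemma WvarB1 t y : Wvar y (t - 1) = Wvar y t / p.
Proof. by rewrite mulNr -qpowN -qpowD; congr (- Q _); ring. Qed.

(** Raising t by 1 multiplies the prefactor of [kext] by q^n, whence the factor on the left. *)
Lemma kext_raise v t n y : Yvar y != Wvar y t ->
  Q n%:R * kext v t n y =
    raise_coef (Yvar y) (Wvar y t) * kext v (t + 1) n (y - 1)
  + raise_coef (Wvar y t) (Yvar y) * kext v (t + 1) n y.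
Proof.
move=> YW; rewrite /kext YvarB1 WvarBD WvarD1.
rewrite phi_raise ?Yvar_neq0 ?Wvar_neq0 //.
have -> : - Q (t + 1 - v - N%:R / 2 + 1 / 2)
    = Q 1 * - Q (t - v - N%:R / 2 + 1 / 2).
  by rewrite mulrN -qpowD; congr (- Q _); ring.
rewrite [(Q 1 * _) ^+ n]exprMn -[Q 1 ^+ n]qpowMn mulr1 /raise_coef; ring.
Qed.

(** Lowering t multiplies the prefactor by q^(-n), and the factor p^(-n) = q^(2n) of [phi_lower]
    restores q^n. As in [kext_raise] the factor is q^n, so any two of these relations compose to
    q^(2n). *)
Lemma kext_lower v t n y : (n <= N)%N -> Yvar y != Wvar y t ->
  Q n%:R * kext v t n y =
    lower_coef (Yvar y) (Wvar y t) * kext v (t - 1) n y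
  + lower_coef (Wvar y t) (Yvar y) * kext v (t - 1) n (y + 1).
Proof.
move=> lenN YW; rewrite /kext YvarD1 WvarDB WvarB1.
have -> : - Q (t - 1 - v - N%:R / 2 + 1 / 2)
    = Q (- 1) * - Q (t - v - N%:R / 2 + 1 / 2).
  by rewrite mulrN -qpowD; congr (- Q _); ring.
rewrite [(Q (- 1) * _) ^+ n]exprMn -[Q (- 1) ^+ n]qpowMn.
have -> : Q n%:R = Q (n%:R * -1) * p ^- n.
  by rewrite -[p ^+ n]qpowMn -qpowN -qpowD; congr Q; ring.
rewrite -mulrA [p ^- n * _]mulrCA phi_lower ?Yvar_neq0 ?Wvar_neq0 //.
rewrite /lower_coef; ring.
Qed.

Section Contiguous.
Variables (v t y : R[i]).
Hypotheses (YW : Yvar y != Wvar y t) (YpW : Yvar y * p != Wvar y t)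
  (YWp : Yvar y != Wvar y t * p).

Let Y := Yvar y.
Let W := Wvar y t.

(** A raising step followed by a lowering step, so t is restored. [YW], [YpW] and [YWp] keep Y and W
    apart at the starting point and at the two intermediate points. *)
Lemma kext_contiguous0 n : (n <= N)%N ->
  Q (2 * n%:R) * kext v t n y =
    raise_coef Y W * lower_coef (Y * p) W * kext v t n (y - 1)
  + (raise_coef Y W * lower_coef W (Y * p)
     + raise_coef W Y * lower_coef Y (W * p)) * kext v t n y
  + raise_coef W Y * lower_coef (W * p) Y * kext v t n (y + 1).
Proof.
move=> lenN; rewrite mulr_natl mulr2n qpowD -mulrA kext_raise // mulrDr.
rewrite ![Q n%:R * (raise_coef _ _ * _)]mulrCA !kext_lower //.
- by rewrite addrK subrK YvarB1 WvarBD WvarD1 -/Y -/W; ring.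
- by rewrite WvarD1.
- by rewrite YvarB1 WvarBD.
Qed.

Lemma kext_contiguousD n :
  Q (2 * n%:R) * kext v t n y =
    raise_coef Y W * raise_coef (Y * p) W * kext v (t + 2) n (y - 2)
  + (raise_coef Y W * raise_coef W (Y * p)
     + raise_coef W Y * raise_coef Y (W * p)) * kext v (t + 2) n (y - 1)
  + raise_coef W Y * raise_coef (W * p) Y * kext v (t + 2) n y.
Proof.
rewrite mulr_natl mulr2n qpowD -mulrA kext_raise // mulrDr.
rewrite ![Q n%:R * (raise_coef _ _ * _)]mulrCA !kext_raise //.
- have [-> ->] : t + 1 + 1 = t + 2 /\ y - 1 - 1 = y - 2 by split; ring.
  rewrite YvarB1 WvarBD WvarD1 -/Y -/W; ring.
- by rewrite WvarD1.
- by rewrite YvarB1 WvarBD.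
Qed.

Lemma kext_contiguousB n : (n <= N)%N ->
  Q (2 * n%:R) * kext v t n y =
    lower_coef Y W * lower_coef Y (W / p) * kext v (t - 2) n y
  + (lower_coef Y W * lower_coef (W / p) Y
     + lower_coef W Y * lower_coef (Y / p) W) * kext v (t - 2) n (y + 1)
  + lower_coef W Y * lower_coef W (Y / p) * kext v (t - 2) n (y + 2).
Proof.
move=> lenN; rewrite mulr_natl mulr2n qpowD -mulrA kext_lower // mulrDr.
rewrite ![Q n%:R * (lower_coef _ _ * _)]mulrCA !kext_lower //.
- have [-> ->] : t - 1 - 1 = t - 2 /\ y + 1 + 1 = y + 2 by split; ring.
  rewrite YvarD1 WvarDB WvarB1 -/Y -/W; ring.
(* The intermediate points now have parameter t - 1; there Y and W are separated by [YWp] and [YpW]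
   after a division by p. *)
- by rewrite YvarD1 WvarDB; apply: contra YWp => /eqP <-; rewrite divfK.
- by rewrite WvarB1; apply: contra YpW => /eqP ->; rewrite divfK.
Qed.

End Contiguous.
End Contiguity.

(** * Steps and partial sums *)

Lemma step_sum (V : nmodType) (F : int -> V) :
  \sum_(e : step) F (ssval e) = F (- 2) + F (- 1) + F 0 + F 1 + F 2.
Proof.
transitivity (\sum_(e <- [:: - 2; - 1; 0; 1; 2 : int]) F e).
  rewrite -(big_map (@ssval _ _) xpredT F); apply: perm_big.
  apply: uniq_perm => //.
    by rewrite map_inj_uniq ?index_enum_uniq //; exact: val_inj.
  move=> e; apply/mapP/idP => [[a _ ->]|ein]; first exact: ssvalP.
  by exists (SeqSub ein); rewrite ?mem_index_enum.
by rewrite !big_cons big_nil addr0 !addrA.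
Qed.

(* The values allowed for the partial sums of a vector of E_j. *)
Definition partial_ok (m : int) : bool := m \in [:: - 1; 0; 1].
Definition in_range (N y : nat) (e : int) : bool := 0 <= y%:Z + e <= N%:Z.

(** Here m is a partial sum, half of the second index of the coefficient. Of the nine pairs with m
    and m + e in {-1, 0, 1}, the six with e nonzero can leave the range, each only from the listed
    y. *)
Variant out_of_range_spec (N y : nat) : int -> int -> Prop :=
| OutN1_0 of y = 0 : out_of_range_spec N y (- 1) 0
| Out1_0 of y = N : out_of_range_spec N y 1 0
| OutN2_1 of (y = 0 \/ y = 1)%N : out_of_range_spec N y (- 2) 1
| OutN1_1 of y = 0 : out_of_range_spec N y (- 1) 1
| Out1_N1 of y = N : out_of_range_spec N y 1 (- 1)
| Out2_N1 of (y = N \/ y.+1 = N) : out_of_range_spec N y 2 (- 1).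

Lemma out_of_rangeP (N y : nat) (e m : int) : (y <= N)%N -> partial_ok m ->
  partial_ok (m + e) -> ~~ in_range N y e -> out_of_range_spec N y e m.
Proof.
rewrite /partial_ok /in_range !inE => leyN okm oke out.
case/or3P: okm oke => /eqP -> /or3P[] /eqP;
  [move=> E; have {E}E : e = 0 by lia
  |move=> E; have {E}E : e = 1 by lia
  |move=> E; have {E}E : e = 2 by lia
  |move=> E; have {E}E : e = - 1 by lia
  |move=> E; have {E}E : e = 0 by lia
  |move=> E; have {E}E : e = 1 by lia
  |move=> E; have {E}E : e = - 2 by lia
  |move=> E; have {E}E : e = - 1 by lia
  |move=> E; have {E}E : e = 0 by lia]; move: out; rewrite E => out;
  try (constructor; lia); exfalso; lia.
Qed.

(** * The coefficients a_{e,m} as compositions of two-term relations *)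

Section CoefficientTable.
Variables (R : realType) (q : R).
Variable N : nat.
Local Notation Q := (qpow q).
Local Notation p := (qpow q (- 2)).
Local Notation P := (p ^+ N).
Local Notation kext := (kext q N).
Local Notation Yvar := (Yvar q).
Local Notation Wvar := (Wvar q N).

Let p_neq0 : p != 0 := qpow_neq0 q (- 2).

Section Coefficients.
Variables (y : nat) (t : R[i]).
Local Notation Y := (Yvar y%:R).
Local Notation W := (Wvar y%:R t).
Hypotheses (YW : Y != W) (YpW : Y * p != W) (YWp : Y != W * p).
Local Notation r := (Q (- N%:R)).
Local Notation raise_coef := (raise_coef (R := R)).
Local Notation lower_coef := (lower_coef q N).

Let Y0 : Y != 0 := Yvar_neq0 q _.
Let W0 : W != 0 := Wvar_neq0 q N _ _.
Let P0 : P != 0 := expf_neq0 N p_neq0.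
Let YW1 : Y - W != 0. Proof. by rewrite subr_eq0. Qed.
Let YW2 : W - Y != 0. Proof. by rewrite subr_eq0 eq_sym. Qed.
Let YW3 : Y * p - W != 0. Proof. by rewrite subr_eq0. Qed.
Let YW4 : W - Y * p != 0. Proof. by rewrite subr_eq0 eq_sym. Qed.
Let YW5 : Y - W * p != 0. Proof. by rewrite subr_eq0. Qed.
Let YW6 : W * p - Y != 0. Proof. by rewrite subr_eq0 eq_sym. Qed.

(* The powers of q occurring in [coef_frac], as monomials in Y, W, p, P, r. *)
Let E1 : Q (- 4 * y%:R - 2 * t + 2 * N%:R) = - W / Y.
Proof. by rewrite opprK -qpowN -qpowD; congr Q; ring. Qed.
Let E2 : Q (- 4 * y%:R - 2 * t + 2 * N%:R + 2) = - W / (Y * p).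
Proof. by rewrite opprK -qpowD -qpowN -qpowD; congr Q; ring. Qed.
Let E3 : Q (- 4 * y%:R - 2 * t + 2 * N%:R - 2) = - W * p / Y.
Proof. by rewrite opprK -qpowN -!qpowD; congr Q; ring. Qed.
Let E4 : Q (- 4 * y%:R - 2 * t + 3 * N%:R + 2) = r * - W / (Y * p * P).
Proof. by rewrite expr_pN opprK -!qpowD -qpowN -qpowD; congr Q; ring. Qed.
Let E5 : Q (- 2 * y%:R) = Y^-1.
Proof. by rewrite -qpowN; congr Q; ring. Qed.
Let E6 : Q (- 2 * y%:R - 2 * t) = - (W * P).
Proof. by rewrite expr_pN [W * _]mulNr opprK -qpowD; congr Q; ring. Qed.
Let E7 : Q (- 2 * y%:R + 2 * N%:R) = (Y * P)^-1.
Proof. by rewrite expr_pN -qpowD -qpowN; congr Q; ring. Qed.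
Let E8 : Q (- 2 * y%:R - 2 * t + 2 * N%:R) = - W.
Proof. by rewrite opprK; congr Q; ring. Qed.
Let E9 : Q (4 * y%:R + 2 * t - 2 * N%:R) = - Y / W.
Proof. by rewrite invrN mulrNN -qpowN -qpowD; congr Q; ring. Qed.
Let E10 : Q (4 * y%:R + 2 * t - 2 * N%:R - 2) = - Y * p / W.
Proof. by rewrite invrN mulNr mulrNN -qpowN -!qpowD; congr Q; ring. Qed.
Let E11 : Q (4 * y%:R + 2 * t - 2 * N%:R + 2) = - Y / (W * p).
Proof. by rewrite [W * p]mulNr invrN mulrNN -qpowD -qpowN -!qpowD; congr Q; ring. Qed.
Let E12 : Q (2 * N%:R - 4 * y%:R - 2 * t) = - W / Y.
Proof. by rewrite -E1; congr Q; ring. Qed.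
Let E13 : Q (2 * N%:R - 4 * y%:R - 2 * t - 2) = - W * p / Y.
Proof. by rewrite -E3; congr Q; ring. Qed.
Let E14 : Q (2 * N%:R - 4 * y%:R - 2 * t + 2) = - W / (Y * p).
Proof. by rewrite -E2; congr Q; ring. Qed.
Let E15 : Q 2 = p^-1.
Proof. by rewrite -qpowN opprK. Qed.
Let E16 : Q (2 * N%:R - 2 * y%:R - 2 * t) = - W.
Proof. by rewrite opprK. Qed.
Let E17 : Q (2 * N%:R - 2 * y%:R - 2 * t - 2) = - (W * p).
Proof. by rewrite mulNr opprK -qpowD; congr Q; ring. Qed.
Let E18 : Q (2 * y%:R + 2 * t) = - (P * W)^-1.
Proof. by rewrite expr_pN mulrN invrN opprK -qpowD -qpowN; congr Q; ring. Qed.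
Let E19 : Q (2 * y%:R + 2 * t - 2) = - p / (P * W).
Proof. by rewrite expr_pN mulrN invrN mulrNN -qpowD -qpowN -qpowD; congr Q; ring. Qed.
Let E20 : Q (2 * N%:R - 2 * y%:R) = (P * Y)^-1.
Proof. by rewrite expr_pN -qpowD -qpowN; congr Q; ring. Qed.
Let E21 : Q (2 * N%:R - 2 * y%:R - 2) = p / (P * Y).
Proof. by rewrite expr_pN -qpowD -qpowN -qpowD; congr Q; ring. Qed.
Let E22 : Q (2 * y%:R - 2) = Y * p.
Proof. by rewrite -qpowD. Qed.
Let E23 : Q (2 * y%:R) = Y.
Proof. by []. Qed.

Let E := (E1, E2, E3, E4, E5, E6, E7, E8, (E9, E10, E11, E12, E13, E14, E15, E16),
  (E17, E18, E19, E20, E21, E22, E23)).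

(** With all powers of q written as monomials, [Y], [W], [P], [p] and [r] become free variables and
    a rational identity remains. *)
Ltac coef_field :=
  rewrite ?E /raise_coef /lower_coef;
  move: Y0 W0 P0 p_neq0 YW1 YW2 YW3 YW4 YW5 YW6;
  move: (r) (Y) (W) (P) (p) => *; field;
  by repeat (apply/andP; split); rewrite ?mulNr // mulrC.

(** Here and in the eight lemmas that follow, the right-hand side is q^(-N) times a coefficient of
    [kext_contiguous0], [kext_contiguousD] or [kext_contiguousB]. *)
Lemma acoef_N1_0 :
  acoef q (- 1) 0 y t N =
  r * (raise_coef Y W * lower_coef (Y * p) W).
Proof. by rewrite /acoef /coef_quot /=; coef_field. Qed.

Lemma acoef_1_0 :
  acoef q 1 0 y t N =
  r * (raise_coef W Y * lower_coef (W * p) Y).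
Proof. by rewrite /acoef /coef_quot /=; coef_field. Qed.

(** Consistent with the definition of a_{0,0} as a difference: the three coefficients of
    [kext_contiguous0] add up to 1, as its case n = 0 shows, where [kext] is 1. *)
Lemma acoef_0_0 :
  acoef q 0 0 y t N =
  r * (raise_coef Y W * lower_coef W (Y * p)
       + raise_coef W Y * lower_coef Y (W * p)).
Proof. by rewrite /acoef /coef_quot /=; coef_field. Qed.

Lemma acoef_N2_2 :
  acoef q (- 2) 2 y t N =
  r * (raise_coef Y W * raise_coef (Y * p) W).
Proof. by rewrite /acoef /coef_quot /=; coef_field. Qed.

Lemma acoef_N1_2 :
  acoef q (- 1) 2 y t N =
  r * (raise_coef Y W * raise_coef W (Y * p)
       + raise_coef W Y * raise_coef Y (W * p)).
Proof. by rewrite /acoef /coef_quot /=; coef_field. Qed.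

Lemma acoef_0_2 :
  acoef q 0 2 y t N =
  r * (raise_coef W Y * raise_coef (W * p) Y).
Proof. by rewrite /acoef /coef_quot /=; coef_field. Qed.

Lemma acoef_0_N2 :
  acoef q 0 (- 2) y t N =
  r * (lower_coef Y W * lower_coef Y (W / p)).
Proof. by rewrite /acoef /coef_quot /=; coef_field. Qed.

Lemma acoef_1_N2 :
  acoef q 1 (- 2) y t N =
  r * (lower_coef Y W * lower_coef (W / p) Y
       + lower_coef W Y * lower_coef (Y / p) W).
Proof. by rewrite /acoef /coef_quot /=; coef_field. Qed.

Lemma acoef_2_N2 :
  acoef q 2 (- 2) y t N =
  r * (lower_coef W Y * lower_coef W (Y / p)).
Proof. by rewrite /acoef /coef_quot /=; coef_field. Qed.

(** The denominators of a_{-2,2} and a_{1,0} contain 1 - Y/W, 1 - Y p/W and 1 - W p/Y, which give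
    the three separations. *)
Lemma Yvar_Wvar_separated : (forall e m : int, (coef_frac q e m y t N).2 != 0) ->
  [/\ Y != W, Y * p != W & Y != W * p].
Proof.
have neq (a b : R[i]) : b != 0 -> 1 + - a / b != 0 -> a != b.
  by move=> b0; apply: contraNneq => ->; rewrite mulNr divff // subrr.
move=> den; have /= := den (- 2) 2; have /= := den 1 0.
rewrite ?E !mulf_eq0 !negb_or => /andP[_ h3] /andP[h1 h2]; split.
- exact: neq.
- by apply: neq => //; rewrite -[- (_ * _)]mulNr.
- by rewrite eq_sym; apply: neq => //; rewrite -[- (_ * _)]mulNr.
Qed.

End Coefficients.
End CoefficientTable.

(** * The convolution identity in y *)

Section Convolution.
Variables (R : realType) (q : R).
Hypotheses (q_gt0 : 0 < q) (q_neq1 : q != 1).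
Variable N : nat.
Local Notation Q := (qpow q).
Local Notation kext := (kext q N).
Local Notation Yvar := (Yvar q).
Local Notation Wvar := (Wvar q N).

(** In each case the numerator has a factor 1 - q^0. *)
Lemma acoef_out_of_range (y : nat) (t : R[i]) (e m : int) : (y <= N)%N ->
  partial_ok m -> partial_ok (m + e) -> ~~ in_range N y e ->
  acoef q e (2 * m) y t N = 0.
Proof.
move=> leyN okm oke out.
have Q0 (z : R[i]) : z = 0 -> 1 - Q z = 0 by move=> ->; rewrite qpow0 subrr.
case: (out_of_rangeP leyN okm oke out) => [yE|yE|[]yE|yE|yE|[]yE];
  rewrite /acoef /coef_quot /=.
- by rewrite (Q0 (- 2 * _)) ?mulr0 ?mul0r // yE mulr0.
- by rewrite (Q0 (- 2 * _ + _)) ?mulr0 ?mul0r // yE; ring.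
- by rewrite (Q0 (2 * y%:R)) ?mulr0 ?mul0r // yE mulr0.
- by rewrite (Q0 (2 * _ - 2)) ?mulr0 ?mul0r // yE; ring.
- by rewrite (Q0 (2 * y%:R)) ?mulr0 ?mul0r // yE mulr0.
- by rewrite (Q0 (2 * _ - 2 * _)) ?mulr0 ?mul0r // yE; ring.
- by rewrite (Q0 (2 * _ - 2 * _)) ?mulr0 ?mul0r // yE; ring.
- by rewrite (Q0 (2 * _ - 2 * _ - 2)) ?mulr0 ?mul0r // -yE -natr1; ring.
Qed.

Lemma acoef_conv (y : nat) (v t : R[i]) n (m : int) :
  (forall e m : int, (coef_frac q e m y t N).2 != 0) ->
  (y <= N)%N -> (n <= N)%N -> partial_ok m ->
  \sum_(e : step | partial_ok (m + ssval e) && in_range N y (ssval e))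
     acoef q (ssval e) (2 * m) y t N
     * kpoly q v (t + (2 * m)%:~R) n `|y%:Z + ssval e| N
  = Q (2 * n%:R - N%:R) * kpoly q v t n y N.
Proof.
move=> den leyN lenN okm.
(* [F] drops the range condition: outside the range [acoef] vanishes and [kext], defined for all
   complex y, supplies a value. *)
pose F (e : int) := if partial_ok (m + e) then acoef q e (2 * m) y t N
     * kext v (t + (2 * m)%:~R) n (y%:R + e%:~R) else 0.
transitivity (\sum_(e : step) F (ssval e)).
  rewrite big_mkcond; apply: eq_bigr => e _; rewrite /F.
  case: ifPn => /=; last first.
    rewrite negb_and; case: (boolP (partial_ok _)) => //= oke out.
    by rewrite acoef_out_of_range // mul0r.
  case/andP=> -> /andP[ge0 _]; rewrite kpolyE //; congr (_ * kext _ _ _ _).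
  by rewrite natr_absz ger0_norm // rmorphD.
rewrite step_sum /F kpolyE //.
have [YW YpW YWp] := Yvar_Wvar_separated den.
rewrite [2 * n%:R - _]addrC qpowD -mulrA.
have [e1 e2 e3 e4 e5] : [/\ y%:R + (- 2)%:~R = y%:R - 2 :> R[i],
    y%:R + (- 1)%:~R = y%:R - 1 :> R[i], y%:R + 0%:~R = y%:R :> R[i],
    y%:R + 1%:~R = y%:R + 1 :> R[i] & y%:R + 2%:~R = y%:R + 2 :> R[i]].
  by split; rewrite ?rmorphN //= addr0.
rewrite {}e1 {}e2 {}e3 {}e4 {}e5.
move: okm; rewrite /partial_ok !inE => /or3P[] /eqP -> /=; rewrite ?addr0 ?add0r.
- rewrite (_ : 2 * (- 1) = - 2 :> int) // (_ : t + _ = t - 2) ?rmorphN //.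
  rewrite kext_contiguousB //.
  rewrite acoef_0_N2 // acoef_1_N2 // acoef_2_N2 //.
  by ring.
- rewrite mulr0 kext_contiguous0 //.
  rewrite acoef_N1_0 // acoef_0_0 // acoef_1_0 //.
  by ring.
- rewrite mulr1 kext_contiguousD //.
  rewrite acoef_N2_2 // acoef_N1_2 // acoef_0_2 //.
  by ring.
Qed.

End Convolution.

(** * The three-term recurrence in n and its symmetry *)

Lemma tridiagonal_symm (F : comRingType) (N : nat) (cp cm W A B : nat -> F) :
  (forall n, (n < N)%N -> W n * cp n = W n.+1 * cm n.+1) ->
  cp N = 0 -> cm 0%N = 0 ->
  \sum_(n < N.+1) A n * W n * (cp n * B n.+1 + cm n * B n.-1) =
  \sum_(n < N.+1) (cp n * A n.+1 + cm n * A n.-1) * W n * B n.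
Proof.
move=> symW cpN cm0.
(* The balance [symW] brings the sum to a form symmetric in A' and B'. The conditions cp N = 0 and
   cm 0 = 0 remove the index N + 1 and the truncated predecessor of 0. *)
have E (A' B' : nat -> F) :
    \sum_(n < N.+1) A' n * W n * (cp n * B' n.+1 + cm n * B' n.-1) =
    \sum_(n < N) W n * cp n * (A' n * B' n.+1 + A' n.+1 * B' n).
  transitivity (\sum_(n < N.+1) A' n * W n * (cp n * B' n.+1)
      + \sum_(n < N.+1) A' n * W n * (cm n * B' n.-1)).
    by rewrite -big_split; apply: eq_bigr => n _; rewrite mulrDr.
  rewrite big_ord_recr big_ord_recl /= cpN cm0 !mul0r !mulr0 addr0 add0r.
  rewrite -big_split; apply: eq_bigr => n _ /=.
  rewrite [cm _ * _]mulrC mulrA -[A' _ * W _ * _ * _]mulrA.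
  rewrite /bump /= add1n.
  transitivity (W n * cp n * (A' n * B' n.+1) + (W n.+1 * cm n.+1) * (A' n.+1 * B' n)).
    by ring.
  by rewrite -symW //; ring.
rewrite E; transitivity (\sum_(n < N) W n * cp n * (B n * A n.+1 + B n.+1 * A n)).
  by apply: eq_bigr => n _; ring.
by rewrite -E; apply: eq_bigr => n _; ring.
Qed.

(** This is [phi_rec] times -1/(b d), read with b = q^(N-t), r = q^(-N), u = p^n, d = q - q^(-1), g
    the scale [rec_scale v] and W = - b^2/Y. *)
Lemma kpoly_rec_algebra (F : fieldType) (Y b g r d u f0 f1 f2 : F) :
    Y != 0 -> b != 0 -> g != 0 -> r != 0 -> u != 0 ->
  - (- (b * b / Y) + Y) * f0 =
    ((r * r * u^-1)^-1 - 1) * f1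
    - (- (b * b / Y) * Y + (r * r)^-1) / u^-1 * f0
    - - (b * b / Y) * Y * (1 - u^-1^-1) * f2 ->
  (Y / b - b / Y) / d * f0 =
    ((b * r)^-1 - b * r) / d * (u / r) * f0
  + ((u / (r * r) - 1) / d / g * (- (g / b) * f1)
     + (1 - u) / d * g * ((- (g / b))^-1 * f2)).
Proof.
move=> Y0 b0 g0 r0 u0 rec.
transitivity (- (- (b * b / Y) + Y) * f0 * (- (b^-1)) * d^-1).
  by move: d^-1 => e; field; rewrite b0.
rewrite rec; move: d^-1 => e; field.
by rewrite oppr_eq0 oner_neq0 Y0 b0 g0 r0 u0.
Qed.

(** At n = 0 the predecessor is truncated, but both sides carry 1 - p^0 = 0. *)
Lemma lower_index_shift (F : fieldType) (p X d g : F) (f : F -> F) n :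
    p != 0 -> X != 0 ->
  (1 - p ^+ n) / d * g * (X ^+ n.-1 * f (p ^- n.-1)) =
  X ^+ n * ((1 - p ^+ n) / d * g * (X^-1 * f (p ^- n * p))).
Proof.
move=> p0 X0; case: n => [|n]; first by rewrite expr0 subrr !mul0r mulr0.
rewrite [p ^- n.+1 * p](_ : _ = p ^- n); last by rewrite exprSr invfM divfK.
by rewrite [X ^+ n.+1]exprSr -[X ^+ n * X * _]mulrA [X * _]mulrCA mulVKf // mulrCA.
Qed.

Section ThreeTermRecurrence.
Variables (R : realType) (q : R).
Hypotheses (q_gt0 : 0 < q) (q_neq1 : q != 1).
Variable N : nat.
Local Notation Q := (qpow q).
Local Notation p := (qpow q (- 2)).
Local Notation P := (p ^+ N).
Local Notation kext := (kext q N).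
Local Notation Yvar := (Yvar q).
Local Notation Wvar := (Wvar q N).

Let p_neq0 : p != 0 := qpow_neq0 q (- 2).
Let p_nroot : forall k, (0 < k)%N -> p ^+ k != 1 :=
  qpow_N2_expr_neq1 q_gt0 q_neq1.

(** The prefactor of [kext] is the n-th power of - [rec_scale v] q^(t-N). Splitting off q^(t-N)
    keeps t out of [rec_up] and [rec_down]. *)
Definition rec_scale (v : R[i]) : R[i] := Q (1 / 2 - v + N%:R / 2).
Definition rec_up (v : R[i]) (n : nat) : R[i] :=
  (p ^+ n / P - 1) / (Q 1 - Q (- 1)) / rec_scale v.
Definition rec_down (v : R[i]) (n : nat) : R[i] :=
  (1 - p ^+ n) / (Q 1 - Q (- 1)) * rec_scale v.

Lemma rec_upN v : rec_up v N = 0.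
Proof. by rewrite /rec_up divff ?subrr ?mul0r ?expf_neq0. Qed.

Lemma rec_down0 v : rec_down v 0 = 0.
Proof. by rewrite /rec_down subrr !mul0r. Qed.

Lemma kpoly_rec v t n y : (n <= N)%N -> (y <= N)%N ->
  qbrack q (t + 2 * y%:R - N%:R) * kpoly q v t n y N =
    qbrack q t * Q (N%:R - 2 * n%:R) * kpoly q v t n y N
  + (rec_up v n * kpoly q v t n.+1 y N + rec_down v n * kpoly q v t n.-1 y N).
Proof.
move=> lenN leyN.
(* For n = N the index N + 1 is outside the scope of [kpolyE], but there [rec_up] is 0. *)
have -> : rec_up v n * kpoly q v t n.+1 y N = rec_up v n * kext v t n.+1 y%:R.
  have [->|nN] := eqVneq n N; first by rewrite rec_upN !mul0r.
  by rewrite kpolyE // ltn_neqAle nN.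
rewrite !kpolyE ?(leq_trans (leq_pred n)) // /kext.
have YN0 : qpoch (Yvar y%:R) p N.+1 = 0.
  by rewrite Yvar_nat (@qpoch_eq0 _ _ _ y) ?ltnS // mulVf ?expf_neq0.
set b := Q (N%:R - t); set g := rec_scale v; set r := Q (- N%:R).
have b0 : b != 0 := qpow_neq0 _ _.
have g0 : g != 0 := qpow_neq0 _ _.
have r0 : r != 0 := qpow_neq0 _ _.
have Y0 : Yvar y%:R != 0 := qpow_neq0 _ _.
have PE : P = r * r by rewrite expr_pN -qpowD; congr Q; ring.
have WE : Wvar y%:R t = - (b * b / Yvar y%:R).
  by rewrite -qpowN -!qpowD; congr (- Q _); ring.
have -> : - Q (t - v - N%:R / 2 + 1 / 2) = - (g / b).
  by rewrite -qpowN -qpowD; congr (- Q _); field.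
have pn0 : p ^+ n != 0 by rewrite expf_neq0.
have := phi_rec p_neq0 p_nroot (Wvar y%:R t) (invr_neq0 pn0) YN0.
have -> : p ^- n / p = p ^- n.+1 by rewrite exprSr invfM.
rewrite PE WE.
rewrite /qbrack.
have -> : Q (t + 2 * y%:R - N%:R) = Yvar y%:R / b.
  by rewrite -qpowN -qpowD; congr Q; ring.
have -> : Q (- (t + 2 * y%:R - N%:R)) = b / Yvar y%:R.
  by rewrite -qpowN -qpowD; congr Q; ring.
have -> : Q t = (b * r)^-1 by rewrite -qpowD -qpowN; congr Q; ring.
have -> : Q (- t) = b * r by rewrite -qpowD; congr Q; ring.
have -> : Q (N%:R - 2 * n%:R) = p ^+ n / r.
  by rewrite -qpowMn -qpowN -qpowD; congr Q; ring.
rewrite /rec_up /rec_down -/g PE.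
move: (Q 1 - Q (- 1)) => d.
set X := - (g / b); have X0 : X != 0.
  by rewrite oppr_eq0 mulf_neq0 // invr_neq0.
set W := - (b * b / _); set f0 := phi _ _ _ _ _; set f1 := phi _ _ _ _ _.
set f2 := phi _ _ _ _ _ => rec.
have -> := @lower_index_shift _ p X d g (fun z => phi p N z (Yvar y%:R) W) n p_neq0 X0.
rewrite -/f2 mulrCA (kpoly_rec_algebra d Y0 b0 g0 r0 pn0 rec) -/X exprSr.
move: f0 f1 f2 (X ^+ n) (p ^+ n) {rec} => *; ring.
Qed.

End ThreeTermRecurrence.

(** * One-leg sums *)

Section OneLeg.
Variables (R : realType) (q : R).
Hypotheses (q_gt0 : 0 < q) (q_neq1 : q != 1).
Variable N : nat.
Local Notation Q := (qpow q).
Local Notation p := (qpow q (- 2)).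
Local Notation P := (p ^+ N).
Local Notation rec_up := (rec_up q N).
Local Notation rec_down := (rec_down q N).
Local Notation rec_scale := (rec_scale q N).


Lemma qpow2_nroot k : (0 < k)%N -> Q 2 ^+ k != 1.
Proof.
by move=> k0; rewrite -qpowMn -natrM qpow_nat_neq1 // muln_gt0 k0.
Qed.

Definition Kweight (n : nat) : R[i] := Q (2 * n%:R - N%:R).

Lemma weight_symm n : (n < N)%N ->
  weight q n N * Kweight n * rec_up 1 n =
  weight q n.+1 N * Kweight n.+1 * rec_down 1 n.+1.
Proof.
move=> ltnN; rewrite /weight /qbinom /Kweight /rec_up /rec_down.
have -> : (N - n)%N = (N - n.+1).+1 by rewrite subnSK.
rewrite !qpochSr -!exprS.
have := one_sub_expr_neq0 qpow2_nroot n.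
have := one_sub_expr_neq0 qpow2_nroot (N - n.+1).
have := qpoch_p_neq0 qpow2_nroot n.
have := qpoch_p_neq0 qpow2_nroot (N - n.+1).
move: (qpoch _ _ _) (qpoch _ _ n) (qpoch _ _ (N - _)) => C0 A D D0 A0.
move: (Q 1 - Q (- 1)) => d.
set g := rec_scale 1; set r := Q (- N%:R); set q1 := Q 1; set u := Q (2 * n%:R).
have g0 : g != 0 := qpow_neq0 _ _.
have q0 : q1 != 0 := qpow_neq0 _ _.
have u0 : u != 0 := qpow_neq0 _ _.
(* [rec_scale 1] is q^((N-1)/2), so q^(-N) is rational in q and this scale. *)
have rE : r = (q1 * (g * g))^-1.
  by rewrite -!qpowD -qpowN; congr Q; field.
have -> : p ^+ n = u^-1 by rewrite -qpowMn -qpowN; congr Q; ring.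
have -> : p ^+ n.+1 = (u * (q1 * q1))^-1.
  by rewrite -qpowMn -!qpowD -qpowN; congr Q; ring.
have -> : P = r * r by rewrite expr_pN -qpowD; congr Q; ring.
have -> : Q 2 ^+ n.+1 = u * (q1 * q1).
  by rewrite -qpowMn -!qpowD; congr Q; ring.
have -> : Q 2 ^+ (N - n.+1).+1 = (r * r * u)^-1.
  rewrite subnSK // -qpowMn -!qpowD -qpowN natrB 1?ltnW //; congr Q; ring.
have -> : Q (n.+1%:R * (n.+1%:R - N%:R)) = Q (n%:R * (n%:R - N%:R)) * (u * q1 * r).
  by rewrite -!qpowD; congr Q; ring.
have -> : Q (2 * n%:R - N%:R) = u * r by rewrite -qpowD.
have -> : Q (2 * n.+1%:R - N%:R) = u * r * (q1 * q1).
  by rewrite -!qpowD; congr Q; ring.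
move: (Q _) => c; rewrite {}rE; move: d^-1 => e.
move: g q1 u g0 q0 u0 A0 D0 => g q1 u g0 q0 u0 A0 D0 h1 h2.
have h3 : u - q1 * (g * g) * (q1 * (g * g)) != 0.
  by apply: contraNneq h1 => /subr0_eq ->; apply/eqP; field; rewrite g0 q0.
by field; rewrite g0 q0 u0 A0 D0 h2 h3.
Qed.

(* With h = h_M(y,t), the numbers [mixL v] and [mixR v] are such that
   mixL v [h] + mixR v [h + 2 sigma] is the factor of A in B, for sigma = -1, 0, 1
   (see [mix_qbrack]). *)
Definition mixR (v : R[i]) : R[i] := (Q (1 - v) - Q (v - 1)) / (Q 2 - Q (- 2)).
Definition mixL (v : R[i]) : R[i] := Q (1 - v) - mixR v * Q 2.

Lemma qpow_diff_neq0 : Q 2 - Q (- 2) != 0.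
Proof.
rewrite subr_eq0; apply: contra (qpow2_nroot (isT : (0 < 2)%N)) => /eqP E.
by rewrite expr2 {2}E -qpowD subrr qpow0.
Qed.

(** With [mix_down], the linear system that fixes [mixL] and [mixR]: the values at q^2 and q^(-2)
    are the factors that turn [rec_up v] and [rec_down v] into [rec_up 1] and [rec_down 1]. *)
Lemma mix_up v : mixL v + mixR v * Q 2 = Q (1 - v).
Proof. by rewrite /mixL subrK. Qed.

Lemma mix_down v : mixL v + mixR v * p = Q (v - 1).
Proof.
have h : mixR v * (Q 2 - p) = Q (1 - v) - Q (v - 1).
  by rewrite divfK ?qpow_diff_neq0.
transitivity (Q (1 - v) - mixR v * (Q 2 - p)); first by rewrite /mixL; ring.
by rewrite h; ring.
Qed.

Lemma rec_up_mix v n : rec_up v n * Q (1 - v) = rec_up 1 n.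
Proof.
rewrite /rec_up; have -> : rec_scale v = rec_scale 1 * Q (1 - v).
  by rewrite -qpowD; congr Q; ring.
by rewrite invfM !mulrA mulfVK // qpow_neq0.
Qed.

Lemma rec_down_mix v n : rec_down v n * Q (v - 1) = rec_down 1 n.
Proof.
rewrite /rec_down; have -> : rec_scale 1 = rec_scale v * Q (v - 1).
  by rewrite -qpowD; congr Q; ring.
by rewrite mulrA.
Qed.

(* The factor of R_r contributed by one leg, without and with the extra weight
   q^(2n-N). *)
Definition rho (x : nat) (s v t : R[i]) (y : nat) : R[i] :=
  \sum_(n < N.+1) kpoly q 1 s n x N * kpoly q v t n y N * weight q n N.

Definition rhoK (x : nat) (s v t : R[i]) (y : nat) : R[i] :=
  \sum_(n < N.+1)
     kpoly q 1 s n x N * (Kweight n * kpoly q v t n y N) * weight q n N.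

Section Shift.
Variables (v t : R[i]) (y : nat) (m : int).
Hypotheses (den : forall e m : int, (coef_frac q e m y t N).2 != 0)
  (leyN : (y <= N)%N) (okm : partial_ok m).
Local Notation admissible e :=
  (partial_ok (m + ssval e) && in_range N y (ssval e)).
Local Notation a e := (acoef q (ssval e) (2 * m) y t N).
Local Notation t' := (t + (2 * m)%:~R).
Local Notation y' e := (absz (y%:Z + ssval e)).
Local Notation h' e := (t' + 2 * (y' e)%:R - N%:R).

(** This is [acoef_conv] summed over n. The result is independent of m, which lets the legs be
    summed successively. *)
Lemma rho_conv x s :
  \sum_(e : step | admissible e) a e * rho x s v t' (y' e) = rhoK x s v t y.
Proof.
under eq_bigr do rewrite mulr_sumr.
rewrite exchange_big; apply: eq_bigr => n _ /=.
have lenN : (n <= N)%N by rewrite -ltnS.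
rewrite /Kweight -(@acoef_conv _ _ q_gt0 q_neq1 N y v t n m den leyN lenN okm).
rewrite mulr_sumr mulr_suml.
by apply: eq_bigr => e _; ring.
Qed.

(** The recurrence is applied at (t, y) in the [mixL] term and at the shifted points in the [mixR]
    term. The neighbours then carry q^(2n-N) and q^(2(n+1)-N) or q^(2(n-1)-N), that is q^(2n-N)
    times [mixL] + [mixR] q^2 or q^(-2), which replaces v by 1. *)
Lemma kpoly_mixed n : (n <= N)%N ->
  mixL v * (Kweight n * (qbrack q (t + 2 * y%:R - N%:R) * kpoly q v t n y N))
  + mixR v * \sum_(e : step | admissible e)
      a e * (qbrack q (h' e) * kpoly q v t' n (y' e) N)
  = (mixL v * qbrack q t + mixR v * qbrack q t') * kpoly q v t n y N
  + Kweight n * (rec_up 1 n * kpoly q v t n.+1 y N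
                 + rec_down 1 n * kpoly q v t n.-1 y N).
Proof.
move=> lenN.
have lepN : (n.-1 <= N)%N := leq_trans (leq_pred n) lenN.
have inv : Kweight n * Q (N%:R - 2 * n%:R) = 1.
  by rewrite -qpowD -(qpow0 q); congr Q; ring.
have -> : \sum_(e : step | admissible e)
      a e * (qbrack q (h' e) * kpoly q v t' n (y' e) N)
   = qbrack q t' * kpoly q v t n y N
   + rec_up v n * (Kweight n.+1 * kpoly q v t n.+1 y N)
   + rec_down v n * (Kweight n.-1 * kpoly q v t n.-1 y N).
  transitivity (\sum_(e : step | admissible e)
     (qbrack q t' * Q (N%:R - 2 * n%:R) * (a e * kpoly q v t' n (y' e) N)
     + rec_up v n * (a e * kpoly q v t' n.+1 (y' e) N)
     + rec_down v n * (a e * kpoly q v t' n.-1 (y' e) N))).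
    apply: eq_bigr => e /andP[_ /andP[ge0 le_e]].
    by rewrite kpoly_rec //; [ring | rewrite -lez_nat gez0_abs].
  rewrite 2!big_split -3!mulr_sumr /=.
  have conv := fun k => @acoef_conv _ _ q_gt0 q_neq1 N y v t k m den leyN.
  rewrite (conv n) // (conv n.-1) //.
  congr (_ + _ + _).
    by rewrite -mulrA [Q _ * (_ * _)]mulrA [Q _ * Kweight n]mulrC inv mul1r.
  have [->|nN] := eqVneq n N; first by rewrite rec_upN !mul0r.
  by rewrite (conv n.+1) // ltn_neqAle nN.
rewrite -(rec_up_mix v) -(rec_down_mix v) -mix_up -mix_down kpoly_rec //.
(* At n = 0 the weight at the truncated predecessor is wrong, but [rec_down] vanishes. *)
have -> : rec_down v n * (Kweight n.-1 * kpoly q v t n.-1 y N)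
    = rec_down v n * (Kweight n * p * kpoly q v t n.-1 y N).
  case: (n) => [|k]; first by rewrite rec_down0 !mul0r.
  by congr (_ * (_ * _)); rewrite -qpowD; congr Q; rewrite -[k.+1%:R]natr1; ring.
have -> : Kweight n.+1 = Kweight n * Q 2.
  by rewrite -qpowD; congr Q; rewrite -natr1; ring.
transitivity (
  mixL v * ((Kweight n * Q (N%:R - 2 * n%:R)) * (qbrack q t * kpoly q v t n y N)
    + Kweight n * (rec_up v n * kpoly q v t n.+1 y N
                 + rec_down v n * kpoly q v t n.-1 y N))
  + mixR v * (qbrack q t' * kpoly q v t n y N
   + rec_up v n * (Kweight n * Q 2 * kpoly q v t n.+1 y N)
   + rec_down v n * (Kweight n * p * kpoly q v t n.-1 y N))).
  by ring.
by rewrite inv mul1r; ring.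
Qed.

Lemma rho_mixed x s : (x <= N)%N ->
  \sum_(e : step | admissible e)
     a e * rho x s v t' (y' e)
     * (mixL v * qbrack q (t + 2 * y%:R - N%:R) + mixR v * qbrack q (h' e))
  = (mixL v * qbrack q t + mixR v * qbrack q t') * rho x s v t y
    + qbrack q (s + 2 * x%:R - N%:R) * rhoK x s v t y
    - qbrack q s * rho x s v t y.
Proof.
move=> lexN.
set f := fun n => kpoly q 1 s n x N; set g := fun n => kpoly q v t n y N.
set w := fun n => weight q n N.
set h := qbrack q (t + 2 * y%:R - N%:R).
transitivity (\sum_(n < N.+1) f n * w n *
  (mixL v * (Kweight n * (h * g n))
  + mixR v * \sum_(e : step | admissible e)
      a e * (qbrack q (h' e) * kpoly q v t' n (y' e) N))).
  transitivity (mixL v * h * rhoK x s v t y + mixR v *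
    \sum_(e : step | admissible e) a e * qbrack q (h' e) * rho x s v t' (y' e)).
    rewrite -rho_conv !mulr_sumr -big_split; apply: eq_bigr => e _ /=; ring.
  under [X in _ + _ * X]eq_bigr do rewrite mulr_sumr.
  rewrite exchange_big /= !mulr_sumr -big_split; apply: eq_bigr => n _ /=.
  rewrite mulrDr; congr (_ + _); first by rewrite /f /g /w; ring.
  rewrite [RHS]mulrCA; congr (_ * _); rewrite mulr_sumr.
  by apply: eq_bigr => e _; rewrite /f /w; ring.
transitivity ((mixL v * qbrack q t + mixR v * qbrack q t') * rho x s v t y
  + \sum_(n < N.+1) f n * (w n * Kweight n) *
      (rec_up 1 n * g n.+1 + rec_down 1 n * g n.-1)).
  rewrite mulr_sumr -big_split; apply: eq_bigr => n _ /=.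
  have lenN : (n <= N)%N by rewrite -ltnS.
  transitivity (f n * w n *
    ((mixL v * qbrack q t + mixR v * qbrack q t') * g n
     + Kweight n * (rec_up 1 n * g n.+1 + rec_down 1 n * g n.-1))).
    by congr (_ * _); exact: kpoly_mixed.
  move: (rec_up _ _) (rec_down _ _) (Kweight _) (qbrack _ _) (qbrack _ _).
  by rewrite /f /g /w => *; ring.
rewrite -addrA; congr (_ + _).
(* X_1 now acts on k_{1,s}, whose own recurrence turns it into [s+2x-N] - [s] q^(N-2n); the last
   power cancels [Kweight]. *)
rewrite (@tridiagonal_symm _ N (rec_up 1) (rec_down 1)
  (fun n => w n * Kweight n) f g) ?rec_upN ?rec_down0 //; last exact: weight_symm.
rewrite !mulr_sumr -sumrB; apply: eq_bigr => n _ /=.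
have lenN : (n <= N)%N by rewrite -ltnS.
have inv : Kweight n * Q (N%:R - 2 * n%:R) = 1.
  by rewrite -qpowD -(qpow0 q); congr Q; ring.
transitivity ((qbrack q (s + 2 * x%:R - N%:R) * f n) * (w n * Kweight n) * g n
  - qbrack q s * f n * w n * g n * (Kweight n * Q (N%:R - 2 * n%:R))).
  by rewrite kpoly_rec // -/(f n) -/(f n.+1) -/(f n.-1); ring.
by rewrite inv /f /g /w; ring.
Qed.

End Shift.
End OneLeg.

(** * Sums over paths *)

(** The ranges depend on i, so they are embedded into one ordinal large enough for all of them
    before distributing. *)
Lemma prod_sum_dffun (A : comPzSemiRingType) (I : finType) (N : I -> nat)
    (f : I -> nat -> A) :
  \prod_i \sum_(n < (N i).+1) f i n =
  \sum_(n : {dffun forall i, 'I_(N i).+1}) \prod_i f i (n i).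
Proof.
pose S := (\max_i N i)%N.
have leS i : ((N i).+1 <= S.+1)%N by rewrite ltnS leq_bigmax.
under eq_bigr => i _ do rewrite (big_ord_widen S.+1 (f i) (leS i)).
rewrite (bigA_distr_big_dep (fun i (j : 'I_S.+1) => j < (N i).+1)%N) /=.
pose h (n : {dffun forall i, 'I_(N i).+1}) : {ffun I -> 'I_S.+1} :=
  [ffun i => widen_ord (leS i) (n i)].
pose h' (n : {ffun I -> 'I_S.+1}) : {dffun forall i, 'I_(N i).+1} :=
  finfun (fun i => inord (n i) : 'I_(N i).+1).
rewrite (reindex_onto h h') /=.
  apply: eq_big => [n|n _].
    apply/andP; split; first by apply/familyP => i; rewrite ffunE unfold_in /=.
    by apply/eqP/ffunP => i; rewrite !ffunE /= inord_val.
  by apply: eq_bigr => i _; rewrite ffunE.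
move=> n /familyP nN; apply/ffunP => i; apply: val_inj.
by rewrite ffunE /= ffunE inordK //; exact: nN.
Qed.

Section FfunCons.
Variables (T : finType) (M : nat).

Definition fcons (a : T) (e : {ffun 'I_M -> T}) : {ffun 'I_M.+1 -> T} :=
  [ffun i => oapp e a (unlift ord0 i)].

Lemma fcons0 a e : fcons a e ord0 = a.
Proof. by rewrite ffunE unlift_none. Qed.

Lemma fcons_lift a e i : fcons a e (lift ord0 i) = e i.
Proof. by rewrite ffunE liftK. Qed.

Lemma sum_fcons (V : nmodType) (f : {ffun 'I_M.+1 -> T} -> V) :
  \sum_e f e = \sum_a \sum_e f (fcons a e).
Proof.
rewrite pair_bigA /= (reindex (fun u : T * {ffun 'I_M -> T} => fcons u.1 u.2)) //.
exists (fun e : {ffun 'I_M.+1 -> T} =>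
    (e ord0, [ffun i : 'I_M => e (lift ord0 i)])) => [[a e] _|e _] /=.
  by rewrite fcons0; congr (_, _); apply/ffunP => i; rewrite ffunE fcons_lift.
apply/ffunP => i; case: (unliftP ord0 i) => [j ->|->]; last by rewrite fcons0.
by rewrite fcons_lift ffunE.
Qed.

End FfunCons.

Lemma psum0 M (e : {ffun 'I_M -> step}) : psum e 0%N = 0.
Proof. by rewrite /psum big_pred0. Qed.

Lemma psum_fcons M a (e : {ffun 'I_M -> step}) k :
  psum (fcons a e) k.+1 = ssval a + psum e k.
Proof.
rewrite /psum big_mkcond big_ord_recl /= [in RHS]big_mkcond /stepz fcons0.
by congr (_ + _); apply: eq_bigr => i _; rewrite fcons_lift.
Qed.

Lemma psumS M (e : {ffun 'I_M -> step}) (i : 'I_M) :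
  psum e i.+1 = psum e i + stepz e i.
Proof.
rewrite /psum (bigD1 i) //= addrC; congr (_ + _); apply: eq_bigl => l.
by rewrite ltnS ltn_neqAle andbC.
Qed.

(* The interaction of consecutive factors is only through the partial sums, so
   summing out the first coordinate reproduces the same statement for the
   remaining ones. *)
Lemma path_sum (A : comPzRingType) (M : nat) (g : 'I_M -> int -> step -> A)
    (good : nat -> int -> bool) (r b : 'I_M -> A) (u : nat -> int -> A)
    (X : nat -> A) :
  (forall (i : 'I_M) m (e : step), good i m ->
     ~~ good i.+1 (m + ssval e) -> g i m e = 0) ->
  (forall (i : 'I_M) m, good i m -> \sum_e g i m e = b i) ->
  (forall (i : 'I_M) m, good i m ->
     \sum_e g i m e * u i.+1 (m + ssval e)
     = u i m * r i + X i.+1 * b i - X i * r i) ->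
  forall m, good 0%N m ->
    \sum_(e : {ffun 'I_M -> step})
       (\prod_i g i (m + psum e i) (e i)) * u M (m + psum e M)
    = (u 0%N m - X 0%N) * \prod_i r i + X M * \prod_i b i.
Proof.
elim: M g good r b u X => [|M IH] g good r b u X g0 gb gu m good_m.
  transitivity (\sum_(e in {: {ffun 'I_0 -> step}}) u 0%N m).
    apply: eq_big => [e|e _]; first by rewrite inE.
    by rewrite big_ord0 psum0 mul1r addr0.
  rewrite sumr_const card_ffun card_ord expn0 mulr1n !big_ord0.
  by rewrite !mulr1 subrK.
rewrite sum_fcons.
pose r' (i : 'I_M) := r (lift ord0 i); pose b' (i : 'I_M) := b (lift ord0 i).
transitivity (\sum_a g ord0 m a *
  ((u 1%N (m + ssval a) - X 1%N) * \prod_i r' i + X M.+1 * \prod_i b' i)).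
  apply: eq_bigr => a _.
  have [ok|bad] := boolP (good 1%N (m + ssval a)); last first.
    rewrite g0 // mul0r big1 // => e _; rewrite big_ord_recl fcons0 psum0.
    by rewrite addr0 g0 // !mul0r.
  rewrite -(IH (fun i => g (lift ord0 i)) (fun i => good i.+1) r' b'
    (fun i => u i.+1) (fun i => X i.+1)) //; first last.
  - by move=> i m'; exact: (gu (lift ord0 i)).
  - by move=> i m'; exact: (gb (lift ord0 i)).
  - by move=> i m' e; exact: (g0 (lift ord0 i)).
  rewrite mulr_sumr; apply: eq_bigr => e _.
  rewrite big_ord_recl fcons0 psum0 addr0 psum_fcons addrA -mulrA.
  congr (_ * (_ * _)); apply: eq_bigr => i _.
  by rewrite fcons_lift psum_fcons addrA.
rewrite !big_ord_recl -/r' -/b' /=.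
(* The term X 1 from [gu] cancels the one from the induction hypothesis; this is the telescoping. *)
transitivity ((\sum_a g ord0 m a * u 1%N (m + ssval a)) * \prod_i r' i
  + (\sum_a g ord0 m a) * (X M.+1 * \prod_i b' i - X 1%N * \prod_i r' i)).
  by rewrite !mulr_suml -big_split; apply: eq_bigr => a _ /=; ring.
by rewrite (gu ord0) // gb //=; ring.
Qed.

(** * Assembling the legs *)

Section Mixing.
Variables (R : realType) (q : R).
Hypotheses (q_gt0 : 0 < q) (q_neq1 : q != 1).
Local Notation Q := (qpow q).

Lemma mix_sum v : mixL q v + mixR q v = qbrace q v.
Proof.
have := qpow_diff_neq0 q_gt0 q_neq1.
rewrite /mixL /mixR /qbrace.
have -> : Q (1 - v) = Q 1 / Q v by rewrite -qpowN -qpowD.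
have -> : Q (v - 1) = Q v / Q 1 by rewrite -qpowN -qpowD.
have -> : Q 2 = Q 1 * Q 1 by rewrite -qpowD.
have -> : Q (- 2) = (Q 1 * Q 1)^-1 by rewrite -qpowD -qpowN.
rewrite !qpowN; have := qpow_neq0 q 1; have := qpow_neq0 q v.
move: (Q 1) (Q v) => a w w0 a0 h.
have h1 : a * a * (a * a) - 1 != 0.
  apply: contraNneq h => /subr0_eq E; apply/eqP/(mulfI (mulf_neq0 a0 a0)).
  by rewrite mulrBr E mulfV ?mulf_neq0 // subrr mulr0.
have h2 : a * a + 1 != 0.
  apply: contraNneq h1 => E; apply/eqP.
  by transitivity ((a * a + 1) * (a * a - 1)); [ring | rewrite E mul0r].
by field; rewrite w0 a0 h1 h2.
Qed.

(** The parts in q^h and q^(-h) are treated separately: m = 1 and m = -1 use [mix_up] and [mix_down]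
    in opposite roles, m = 0 uses [mix_sum]. *)
Lemma mix_qbrack v h (m : int) : partial_ok m ->
  mixL q v * qbrack q h + mixR q v * qbrack q (h + (2 * m)%:~R) =
  if m == - 1 then qbrack q (h + v - 1)
  else if m == 1 then qbrack q (h - v + 1) else qbrack q h * qbrace q v.
Proof.
have E1 : mixL q v * qbrack q h + mixR q v * qbrack q (h + 2)
    = qbrack q (h - v + 1).
  rewrite /qbrack opprD [Q (h + 2)]qpowD [Q (- h - 2)]qpowD.
  have -> : Q (h - v + 1) = Q h * Q (1 - v) by rewrite -qpowD; congr Q; ring.
  have -> : Q (- (h - v + 1)) = Q (- h) * Q (v - 1).
    by rewrite -qpowD; congr Q; ring.
  transitivity ((Q h * (mixL q v + mixR q v * Q 2)
    - Q (- h) * (mixL q v + mixR q v * Q (- 2))) / (Q 1 - Q (- 1))).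
    by ring.
  by rewrite mix_up mix_down.
have E2 : mixL q v * qbrack q h + mixR q v * qbrack q (h - 2)
    = qbrack q (h + v - 1).
  rewrite /qbrack opprB [2 - h]addrC [Q (h - 2)]qpowD [Q (- h + 2)]qpowD.
  have -> : Q (h + v - 1) = Q h * Q (v - 1) by rewrite -qpowD; congr Q; ring.
  have -> : Q (- (h + v - 1)) = Q (- h) * Q (1 - v).
    by rewrite -qpowD; congr Q; ring.
  transitivity ((Q h * (mixL q v + mixR q v * Q (- 2))
    - Q (- h) * (mixL q v + mixR q v * Q 2)) / (Q 1 - Q (- 1))).
    by ring.
  by rewrite mix_up mix_down.
rewrite /partial_ok !inE => /or3P[] /eqP -> /=.
- by rewrite -E2 (_ : 2 * (- 1) = - 2 :> int) // rmorphN.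
- by rewrite mulr0 addr0 -mulrDl mix_sum mulrC.
- by rewrite -E1.
Qed.

End Mixing.

(** * Heights and the factorisation of R_r *)

Section Heights.
Variables (R : realType) (M : nat) (N : 'I_M -> nat).

Lemma heightS (y : 'I_M -> nat) (t : R[i]) (i : 'I_M) :
  height N y t i.+1 = height N y t i + 2 * (y i)%:R - (N i)%:R.
Proof.
rewrite /height (bigD1 i) //=.
rewrite (eq_bigl (fun l : 'I_M => (l < i)%N)); first by ring.
by move=> l; rewrite ltnS ltn_neqAle andbC.
Qed.

(** Hence the index m_i of a coefficient is the change of the parameter t at leg i. *)
Lemma height_shift (y : 'I_M -> nat) (t : R[i]) (e : {ffun 'I_M -> step}) k :
  in_box N y e ->
  height N (shift y e) t k = height N y t k + (2 * psum e k)%:~R.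
Proof.
move=> /forallP ye; rewrite /height -addrA; congr (_ + _).
rewrite /psum mulr_sumr rmorph_sum -big_split; apply: eq_bigr => l _ /=.
have /andP[ge0 _] := ye l.
rewrite /shift natr_absz ger0_norm // rmorphD rmorphM /=; ring.
Qed.

(** The heights depend on x and y but not on n, so the sum over n factorises. *)
Lemma Rr_prod (q : R) (s t v : R[i]) (x y : 'I_M -> nat) :
  Rr q N s t v x y =
  \prod_i rho q (N i) (x i) (height N x s i) v (height N y t i) (y i).
Proof.
rewrite /Rr /rho (prod_sum_dffun N (fun i n =>
  kpoly q 1 (height N x s i) n (x i) (N i)
  * kpoly q v (height N y t i) n (y i) (N i) * weight q n (N i))).
by apply: eq_bigr => n _; rewrite -!big_split.
Qed.

End Heights.

Lemma partial_ok_psum M j (e : {ffun 'I_M -> step}) k : e \in Eset M j ->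
  (k <= M)%N -> partial_ok (psum e k).
Proof.
rewrite inE => /andP[_ /forallP ok]; case: k => [|k] kM.
  by rewrite psum0.
exact: ok (Ordinal kM).
Qed.

(** * Summation leg by leg *)

Section LegRecursion.
Variables (R : realType) (q : R) (M : nat) (N x y : 'I_M -> nat) (s t v : R[i]).
Hypotheses (q_gt0 : 0 < q) (q_neq1 : q != 1)
  (x_le : forall i, (x i <= N i)%N) (y_le : forall i, (y i <= N i)%N)
  (den_neq0 : denominators_neq0 q N y t).
Variable j : nat.
Local Notation k := (M - j)%N.
Local Notation Hx := (height N x s).
Local Notation Hy := (height N y t).
Local Notation shifted_height m i := (Hy i + (2 * m)%:~R).

Definition leg_ok (i : 'I_M) (m e : int) : bool :=
  [&& (i < k)%N ==> (e == 0), partial_ok (m + e) & in_range (N i) (y i) e].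

Definition leg_rho (i : 'I_M) (m e : int) : R[i] :=
  rho q (N i) (x i) (Hx i) v (shifted_height m i) (absz ((y i)%:Z + e)).

Definition leg_coef (i : 'I_M) (m e : int) : R[i] :=
  if (k <= i)%N then acoef q e (2 * m) (y i) (Hy i) (N i) else 1.

(** Extended by 0, so that [path_sum] can run over all step vectors. *)
Definition leg_weight (i : 'I_M) (m : int) (e : step) : R[i] :=
  if leg_ok i m (ssval e) then leg_coef i m (ssval e) * leg_rho i m (ssval e)
  else 0.

(* Before position k = M - j all partial sums vanish. *)
Definition leg_good (i : nat) (m : int) : bool :=
  partial_ok m && ((i <= k)%N ==> (m == 0)).

(** The value [b] of [path_sum]; the first M-j legs admit only the step 0 and keep their plain
    sum. *)
Definition leg_rhoK (i : 'I_M) : R[i] :=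
  if (k <= i)%N then rhoK q (N i) (x i) (Hx i) v (Hy i) (y i)
  else leg_rho i 0 0.

Lemma Eset_in_boxE (e : {ffun 'I_M -> step}) :
  (e \in Eset M j) && in_box N y e =
  [forall i, leg_ok i (psum e i) (ssval (e i))].
Proof.
apply/idP/forallP => [/andP[]|ok].
  rewrite inE => /andP[/forallP e0 /forallP ep] /forallP ye i.
  rewrite /leg_ok -/(stepz e i) -psumS.
  by apply/and3P; split; [exact: e0 | exact: ep | exact: ye].
rewrite inE -andbA; apply/and3P; split; apply/forallP => i;
  have := ok i; rewrite /leg_ok -/(stepz e i) -psumS => /and3P[] //.
Qed.

Lemma leg_weight_prod (e : {ffun 'I_M -> step}) :
  \prod_i leg_weight i (psum e i) (e i) =
  if (e \in Eset M j) && in_box N y e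
  then Acoef q N j e y t * Rr q N s t v x (shift y e) else 0.
Proof.
case: ifPn => [ok|]; last first.
  rewrite Eset_in_boxE negb_forall => /existsP[i bad].
  by rewrite (bigD1 i) //= /leg_weight (negPf bad) mul0r.
have ye : in_box N y e by case/andP: ok.
move: ok; rewrite Eset_in_boxE => /forallP ok.
rewrite Rr_prod /Acoef [X in X * _]big_mkcond -big_split.
apply: eq_bigr => i _ /=.
by rewrite /leg_weight ok height_shift.
Qed.

Lemma leg_weight_eq0 (i : 'I_M) (m : int) (e : step) :
  leg_good i m -> ~~ leg_good i.+1 (m + ssval e) -> leg_weight i m e = 0.
Proof.
move=> /andP[okm m0] bad; rewrite /leg_weight ifN //.
apply: contra bad => /and3P[e0 ok _]; rewrite /leg_good ok /=.
apply/implyP => ik; have e0' := implyP e0 ik.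
by rewrite (eqP e0') addr0 (implyP m0) // ltnW.
Qed.

Lemma leg_sum_lt (i : 'I_M) (m : int) (c : int -> R[i]) :
  (i < k)%N -> leg_good i m ->
  \sum_e leg_weight i m e * c (m + ssval e) = leg_rho i 0 0 * c 0.
Proof.
move=> ik /andP[_ /implyP m0].
have -> : m = 0 by apply/eqP/m0/ltnW.
rewrite (step_sum (fun e => (if leg_ok i 0 e then leg_coef i 0 e * leg_rho i 0 e
  else 0) * c (0 + e))).
rewrite /leg_ok /leg_coef ik leqNgt ik /= !mul0r !addr0 !add0r mul1r ifT //.
by rewrite /in_range addr0 !lez_nat y_le.
Qed.

Lemma leg_sum_ge (i : 'I_M) (m : int) (c : step -> R[i]) : (k <= i)%N ->
  \sum_e leg_weight i m e * c e =
  \sum_(e : step | partial_ok (m + ssval e) && in_range (N i) (y i) (ssval e))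
    acoef q (ssval e) (2 * m) (y i) (Hy i) (N i) * leg_rho i m (ssval e) * c e.
Proof.
move=> ki; rewrite [RHS]big_mkcond; apply: eq_bigr => e _.
rewrite /leg_weight /leg_ok /leg_coef ki ltnNge ki /=.
by case: ifP; rewrite ?mul0r.
Qed.

Lemma leg_sum (i : 'I_M) (m : int) : leg_good i m ->
  \sum_e leg_weight i m e = leg_rhoK i.
Proof.
move=> good; have := good => /andP[okm _].
under eq_bigr do rewrite -[leg_weight _ _ _]mulr1.
rewrite /leg_rhoK; case: leqP => [ki|ik].
  rewrite (leg_sum_ge m (fun=> 1)) //; under eq_bigr do rewrite mulr1.
  by rewrite /leg_rho rho_conv // => e' m'; exact: den_neq0.
by rewrite (leg_sum_lt (fun=> 1)) // mulr1.
Qed.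

(** The case u = 1, X = 0 of [path_sum]. The product obtained recurs in [Acoef_Rr_mixed_sum], which
    links the two sums of the theorem. *)
Lemma Acoef_Rr_sum :
  \sum_(e in Eset M j | in_box N y e)
     Acoef q N j e y t * Rr q N s t v x (shift y e) = \prod_i leg_rhoK i.
Proof.
rewrite big_mkcond; under eq_bigr do rewrite -leg_weight_prod.
have := @path_sum _ M leg_weight leg_good leg_rhoK leg_rhoK (fun _ _ => 1)
  (fun=> 0) leg_weight_eq0 leg_sum _ 0.
rewrite subr0 mul1r mul0r addr0 => <- //.
  by apply: eq_bigr => e _; rewrite mulr1; apply: eq_bigr => i _; rewrite add0r.
move=> i m good; rewrite mul1r !mul0r addr0 subr0 -(leg_sum good).
by apply: eq_bigr => e _; rewrite mulr1.
Qed.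

Lemma Acoef_Rr_mixed_sum : (k < M)%N ->
  \sum_(e in Eset M j | in_box N y e)
     (Acoef q N j e y t * Rr q N s t v x (shift y e))
     * (mixL q v * qbrack q (Hy M)
        + mixR q v * qbrack q (shifted_height (psum e M) M)) =
  (qbrace q v * qbrack q (Hy k) - qbrack q (Hx k)) * Rr q N s t v x y
  + qbrack q (Hx M) * \prod_i leg_rhoK i.
Proof.
move=> kM.
(* The index [maxn i k] freezes the heights up to position k, so the first M-j legs add nothing to
   the telescoping. *)
pose u (i : nat) m := mixL q v * qbrack q (Hy (maxn i k))
  + mixR q v * qbrack q (shifted_height m (maxn i k)).
pose X i := qbrack q (Hx (maxn i k)).
pose r i := leg_rho i 0 0.
have rE : Rr q N s t v x y = \prod_i r i.
  rewrite Rr_prod; apply: eq_bigr => i _.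
  by rewrite /r /leg_rho mulr0 !addr0.
have := @path_sum _ M leg_weight leg_good r leg_rhoK u X leg_weight_eq0 leg_sum _ 0.
rewrite rE /u /X max0n (maxn_idPl (ltnW kM)) mulr0 addr0 -mulrDl mix_sum // => <- //.
  rewrite big_mkcond; apply: eq_bigr => e _.
  under [in RHS]eq_bigr do rewrite add0r.
  by rewrite leg_weight_prod add0r; case: ifP; rewrite ?mul0r.
move=> i m good; have := good => /andP[okm _]; cbv beta.
have [ki|ik] := leqP k i; last first.
  rewrite (leg_sum_lt (fun m => mixL q v * qbrack q (Hy (maxn i.+1 k))
  + mixR q v * qbrack q (shifted_height m (maxn i.+1 k)))) //.
  have -> : m = 0 by have /andP[_ /implyP m0] := good; apply/eqP/m0/ltnW.
  rewrite (maxn_idPr ik) /leg_rhoK leqNgt ik /= /r.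
  by ring.
rewrite leg_sum_ge // !(maxn_idPl _) ?(leqW ki) // !heightS /leg_rhoK ki.
have den (e' m' : int) : (coef_frac q e' m' (y i) (Hy i) (N i)).2 != 0.
  exact: den_neq0.
have := @rho_mixed _ _ q_gt0 q_neq1 (N i) v (Hy i) (y i) m den (y_le i) okm
  (x i) (Hx i) (x_le i).
rewrite /r /leg_rho !mulr0 !addr0 => <-.
apply: eq_bigr => e /andP[_ /andP[ge0 _]].
congr (_ * (_ + _ * qbrack q _)).
rewrite natr_absz ger0_norm // rmorphD !rmorphM rmorphD /=; ring.
Qed.

End LegRecursion.

(** The four cases of B become one formula by [mix_qbrack]; only the zero vector has an additional
    term. *)
Lemma BcoefE (R : realType) (q : R) (M : nat) (N : 'I_M -> nat) (v : R[i])
    (j : nat) (e : {ffun 'I_M -> step}) (y : 'I_M -> nat) (t : R[i]) :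
  0 < q -> q != 1 -> e \in Eset M j ->
  Bcoef q N v j e y t =
    Acoef q N j e y t * (mixL q v * qbrack q (height N y t M)
      + mixR q v * qbrack q (height N y t M + (2 * psum e M)%:~R))
    - (if [forall i, stepz e i == 0]
       then qbrack q (height N y t (M - j)%N) * qbrace q v else 0).
Proof.
move=> q_gt0 q_neq1 eE; have ok := partial_ok_psum eE (leqnn M).
rewrite mix_qbrack // /Bcoef.
case: (boolP [forall i, stepz e i == 0]) => [/forallP e0|_].
  have -> : psum e M = 0 by apply: big1 => i _; exact/eqP.
  by rewrite /= mulrA.
by rewrite subr0; do 2?[case: ifP => _ //]; rewrite mulrA.
Qed.

Theorem corollary3p19 (R : realType) (q : R) (M : nat) (N x y : 'I_M -> nat)
    (s t v : R[i]) (q_gt0 : 0 < q) (q_neq1 : q != 1) (M_gt0 : (1 <= M)%N)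
    (x_le : forall i, (x i <= N i)%N) (y_le : forall i, (y i <= N i)%N)
    (den_neq0 : denominators_neq0 q N y t) :
  forall j : nat, (1 <= j <= M)%N ->
    qbrack q (height N x s M) *
      (\sum_(e in Eset M j | in_box N y e)
         Acoef q N j e y t * Rr q N s t v x (shift y e))
    = qbrack q (height N x s (M - j)%N) * Rr q N s t v x y
      + \sum_(e in Eset M j | in_box N y e)
          Bcoef q N v j e y t * Rr q N s t v x (shift y e)
    /\ (forall e : {ffun 'I_M -> step}, e \in Eset M j -> ~~ in_box N y e ->
          Acoef q N j e y t = 0 /\ Bcoef q N v j e y t = 0).
Proof.
move=> j /andP[j_gt0 j_le]; split.
  (* The zero vector, whose extra term in B is split off below as a multiple of R_r(x, y). *)
  pose e0 : {ffun 'I_M -> step} :=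
    [ffun=> SeqSub (isT : 0 \in [:: - 2; - 1; 0; 1; 2 : int])].
  have e0E i : stepz e0 i = 0 by rewrite /stepz ffunE.
  have e0P : (e0 \in Eset M j) && in_box N y e0.
    rewrite inE -andbA; apply/and3P; split; apply/forallP => i.
    - by rewrite e0E eqxx implybT.
    - by rewrite /psum big1 // => l _; rewrite e0E.
    - by rewrite e0E addr0 !lez_nat y_le.
  have kM : (M - j < M)%N by rewrite ltn_subrL j_gt0.
  have mixed := Acoef_Rr_mixed_sum s v q_gt0 q_neq1 x_le y_le den_neq0 kM.
  rewrite (Acoef_Rr_sum x s v q_gt0 q_neq1 y_le den_neq0 j).
  have -> : \sum_(e in Eset M j | in_box N y e)
      Bcoef q N v j e y t * Rr q N s t v x (shift y e) =
    \sum_(e in Eset M j | in_box N y e)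
     (Acoef q N j e y t * Rr q N s t v x (shift y e))
     * (mixL q v * qbrack q (height N y t M)
        + mixR q v * qbrack q (height N y t M + (2 * psum e M)%:~R))
    - qbrack q (height N y t (M - j)%N) * qbrace q v * Rr q N s t v x y.
    rewrite (bigD1 e0) // [in RHS](bigD1 e0) //= BcoefE //; last by case/andP: e0P.
    rewrite ifT; last by apply/forallP => i; rewrite e0E.
    have -> : shift y e0 = y by apply/funext => i; rewrite /shift e0E addr0.
    rewrite mulrBl [in RHS]addrAC mulrAC; congr (_ + _).
    apply: eq_bigr => e /andP[/andP[eE _] ne0]; rewrite BcoefE // ifN ?subr0.
      by rewrite mulrAC.
    apply: contra ne0 => /forallP z; apply/eqP/ffunP => i; apply: val_inj.
    by rewrite ffunE /=; exact/eqP/z.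
  (* The terms in {v} [h_(M-j)(y,t)] and in [h_(M-j)(x,s)] cancel. *)
  by rewrite mixed; ring.
(* A vector leaving the box does so at a leg after the first M-j, where [acoef] vanishes. It is not
   the zero vector, so B has no extra term. *)
move=> e eE out; rewrite BcoefE //.
have -> : Acoef q N j e y t = 0.
  move: out; rewrite negb_forall => /existsP[i out].
  have ki : (M - j <= i)%N.
    rewrite leqNgt; apply: contra out => ik.
    move: eE; rewrite inE => /andP[/forallP/(_ i)/implyP/(_ ik)/eqP -> _].
    by rewrite addr0 !lez_nat y_le.
  rewrite /Acoef (bigD1 i) //= acoef_out_of_range ?mul0r //.
    by rewrite (partial_ok_psum eE) // ltnW.
  by rewrite -psumS (partial_ok_psum eE).
rewrite mul0r sub0r ifN ?oppr0 //.
apply: contra out => /forallP z; apply/forallP => i.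
by rewrite (eqP (z i)) addr0 !lez_nat y_le.
Qed.
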